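(* Let $\mathcal{X},\mathcal{Y},\mathcal{Z}$ be finite sets, $f\subseteq\mathcal{X}\times\mathcal{Y}\times\mathcal{Z}$ a relation, and $t>1$ an integer. Let $\mu$ be a distribution on $\mathcal{X}\times\mathcal{Y}$, let $z\in\mathcal{Z}$ and $\beta:=\Pr_{(x,y)\leftarrow\mu}[f(x,y)=\{z\}]$. Let $0<\varepsilon<1/3$ and $\varepsilon',\delta>0$ be such that $\frac{\delta+22\varepsilon}{\beta-33\varepsilon}<(1+\varepsilon')\frac{\delta}{\beta}$. Then \[\mathrm{R}^{\mathrm{pub}}_{1-(1-\varepsilon)^{\lfloor\varepsilon^2 t/32\rfloor}}(f^t)\;\geq\;\frac{\varepsilon^2}{32}\cdot t\cdot\Big(11\varepsilon\cdot\widetilde{\mathrm{srec}}^{z,\mu}_{(1+\varepsilon')\delta/\beta,\;\delta}(f)-2\Big).\]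
   Context: Notation: for a relation $f$, $f(x,y):=\{z:(x,y,z)\in f\}$ and $f^{-1}(z):=\{(x,y):(x,y,z)\in f\}$. $f^t\subseteq\mathcal{X}^t\times\mathcal{Y}^t\times\mathcal{Z}^t$ is the relation with $((x_1..x_t),(y_1..y_t),(z_1..z_t))\in f^t$ iff $(x_i,y_i,z_i)\in f$ for all $i$. $\mathrm{R}^{\mathrm{pub}}_{\eta}(g)$ is the two-way public-coin randomized communication complexity of $g$ with worst-case error $\eta$: the minimum number of bits communicated by a two-way public-coin protocol whose output is a valid answer (in $g$) with probability at least $1-\eta$ on every input. Smooth rectangle bound: for a distribution $\lambda$ on $\mathcal{X}\times\mathcal{Y}$, a relation $g$, $z\in\mathcal{Z}$ and $\varepsilon\ge0$, $\widetilde{\mathrm{rec}}^{z,\lambda}_{\varepsilon}(g):=\min\{\log_2(1/\lambda(R)) : R=A\times B\subseteq\mathcal{X}\times\mathcal{Y}\text{ a rectangle with }\lambda(R)>0,\ \lambda(g^{-1}(z)\cap R)\ge(1-\varepsilon)\lambda(R)\}$ (equivalently the min of $S_\infty(\lambda_R\|\lambda)$ where $\lambda_R$ is $\lambda$ conditioned on $R$ and $S_\infty(P\|Q)=\max_x\log(P(x)/Q(x))$). For $\delta\ge0$, $\widetilde{\mathrm{srec}}^{z,\lambda}_{\varepsilon,\delta}(f):=\max\{\widetilde{\mathrm{rec}}^{z,\lambda}_{\varepsilon}(g): g\subseteq\mathcal{X}\times\mathcal{Y}\times\mathcal{Z},\ \Pr_{(x,y)\leftarrow\lambda}[f(x,y)\neq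 g(x,y)]\le\delta\}$.
   Formalization: The formal theorem assumes in addition 33ε < β, so that the denominators β − 33ε and β are positive; when 0 < β < 33ε the assumed inequality holds automatically and the claim fails (e.g. for Equality with ε = 0.3). *)

(* Defs.v *)
From Stdlib Require Import Reals.
From mathcomp Require Import all_boot.

Set Implicit Arguments.
Unset Strict Implicit.
Unset Printing Implicit Defensive.

Local Open Scope R_scope.

Definition log2 (x : R) : R := ln x / ln 2.

Definition nat_floor (x : R) : nat := Z.to_nat (Int_part x).

Definition Rmin_seq (s : seq R) : R :=
  match s with [::] => 0 | a :: s' => foldr Rmin a s' end.
Definition Rmax_seq (s : seq R) : R :=
  match s with [::] => 0 | a :: s' => foldr Rmax a s' end.

Definition Rltb (a b : R) : bool := if Rlt_dec a b then true else false.
Definition Rleb (a b : R) : bool := if Rle_dec a b then true else false.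

Definition relation3 (X Y Z : finType) := {set (X * Y * Z)%type}.

Definition rel_at (X Y Z : finType) (f : relation3 X Y Z) (x : X) (y : Y)
  : {set Z} := [set z | (x, y, z) \in f].

Definition rel_pow (X Y Z : finType) (f : relation3 X Y Z) (t : nat)
  (x : {ffun 'I_t -> X}) (y : {ffun 'I_t -> Y}) (z : {ffun 'I_t -> Z}) : bool :=
  [forall i, (x i, y i, z i) \in f].

Definition is_distr (T : finType) (mu : T -> R) : Prop :=
  (forall p, 0 <= mu p) /\ \big[Rplus/0]_(p : T) mu p = 1.

Definition prob (T : finType) (mu : T -> R) (P : pred T) : R :=
  \big[Rplus/0]_(p : T | P p) mu p.

Inductive proto (A B O : Type) : Type :=
| PLeaf  : O -> proto A B O
| PAlice : (A -> bool) -> proto A B O -> proto A B O -> proto A B O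
| PBob   : (B -> bool) -> proto A B O -> proto A B O -> proto A B O.

Fixpoint run (A B O : Type) (P : proto A B O) (a : A) (b : B) : O :=
  match P with
  | PLeaf o => o
  | PAlice g l r => if g a then run l a b else run r a b
  | PBob g l r => if g b then run l a b else run r a b
  end.

Fixpoint depth (A B O : Type) (P : proto A B O) : nat :=
  match P with
  | PLeaf _ => 0
  | PAlice _ l r => (maxn (depth l) (depth r)).+1
  | PBob _ l r => (maxn (depth l) (depth r)).+1
  end.

(* A public-coin protocol: a probability distribution (given by the list of
   weighted deterministic protocols) over deterministic protocols selected by
   the public random string. *)
Definition pubproto (A B O : Type) := seq (R * proto A B O).

Definition pub_wf (A B O : Type) (P : pubproto A B O) : Prop :=
  (forall wp, List.In wp P -> 0 <= wp.1) /\
  \big[Rplus/0]_(wp <- P) wp.1 = 1.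

Definition pub_cost (A B O : Type) (P : pubproto A B O) : nat :=
  \max_(wp <- P) depth wp.2.

Definition pub_err (A B O : Type) (g : A -> B -> O -> bool)
  (P : pubproto A B O) (a : A) (b : B) : R :=
  \big[Rplus/0]_(wp <- P | ~~ g a b (run wp.2 a b)) wp.1.

(* "R^pub_eta(g) >= r": every public-coin protocol whose output is a valid
   answer with probability >= 1 - eta on every input communicates at least r
   bits in the worst case (i.e. min{cost} >= r, with min of the empty set
   being +infinity). *)
Definition Rpub_ge (A B O : Type) (g : A -> B -> O -> bool) (eta r : R)
  : Prop :=
  forall P : pubproto A B O, pub_wf P ->
    (forall a b, pub_err g P a b <= eta) ->
    r <= INR (pub_cost P).

Section SRec.
Variables (X Y Z : finType).

Definition in_rect (AB : {set X} * {set Y}) (p : X * Y) : bool :=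
  (p.1 \in AB.1) && (p.2 \in AB.2).

Definition rect_ok (lam : X * Y -> R) (g : relation3 X Y Z) (z : Z) (eps : R)
  (AB : {set X} * {set Y}) : bool :=
  Rltb 0 (prob lam (in_rect AB)) &&
  Rleb ((1 - eps) * prob lam (in_rect AB))
       (prob lam (fun p => in_rect AB p && (z \in rel_at g p.1 p.2))).

Definition rec (lam : X * Y -> R) (g : relation3 X Y Z) (z : Z) (eps : R) : R :=
  Rmin_seq [seq log2 (/ prob lam (in_rect AB))
           | AB <- enum {: {set X} * {set Y}} & rect_ok lam g z eps AB].

Definition srec (lam : X * Y -> R) (f : relation3 X Y Z) (z : Z)
  (eps delta : R) : R :=
  Rmax_seq [seq rec lam g z eps
           | g <- enum {: relation3 X Y Z}
           & Rleb (prob lam (fun p => rel_at f p.1 p.2 != rel_at g p.1 p.2))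
                  delta].
End SRec.

(* Main.v *)
(** Fix the public coins and let [P] be the distribution of the [t] instances conditioned on
    the protocol being correct on a set [C] of coordinates.  Writing [m] for the leaf reached
    and [r_j] for the inputs of [C] together with [x_i] for [i < j] and [y_i] for [i > j], the
    law of [(x_j, y_j, r_j, m)] under [P] has a density with respect to [mu (x_j, y_j)] that is
    a product of a function of [x_j] and a function of [y_j].  By the chain rule and
    submodularity of entropy, for most [j] the relative entropies of this law with respect to
    [mu (x_j, y_j) P(r_j, m | x_j)] and [mu (x_j, y_j) P(r_j, m | y_j)] are small, so that the
    two players can truncate their factors and sample [(r_j, m)] without communication.  This
    yields random rectangles of measure about [2 ^ (- srec / 2)] on which the output [z] is as
    reliable as the protocol is on coordinate [j].  The smooth rectangle bound forbids this
    reliability, hence conditioned on success on [C] some coordinate fails with probability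
    more than [eps]; adding such coordinates to [C] one at a time gives the theorem. *)

From HB Require Import structures.
Require Import Defs.
From Stdlib Require Import ZArith Reals Lra Psatz.
From mathcomp Require Import all_boot.

Set Implicit Arguments.
Unset Strict Implicit.
Unset Printing Implicit Defensive.

Local Open Scope R_scope.

(** * The real operations as laws for big operators *)

HB.instance Definition _ := Monoid.isComLaw.Build R 0 Rplus
  (fun x y z => esym (Rplus_assoc x y z)) Rplus_comm Rplus_0_l.
HB.instance Definition _ := Monoid.isComLaw.Build R 1 Rmult
  (fun x y z => esym (Rmult_assoc x y z)) Rmult_comm Rmult_1_l.
HB.instance Definition _ := Monoid.isMulLaw.Build R 0 Rmult Rmult_0_l Rmult_0_r.
HB.instance Definition _ := Monoid.isAddLaw.Build R Rmult Rplus
  (fun x y z => Rmult_plus_distr_r x y z)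
  (fun x y z => Rmult_plus_distr_l x y z).

Local Notation "\sum_ ( i <- r | P ) F" := (\big[Rplus/0]_(i <- r | P%B) F) : R_scope.
Local Notation "\sum_ ( i <- r ) F" := (\big[Rplus/0]_(i <- r) F) : R_scope.
Local Notation "\sum_ ( i | P ) F" := (\big[Rplus/0]_(i | P%B) F) : R_scope.
Local Notation "\sum_ i F" := (\big[Rplus/0]_i F) : R_scope.
Local Notation "\sum_ ( i : t ) F" := (\big[Rplus/0]_(i : t) F) (only parsing) : R_scope.
Local Notation "\sum_ ( i : t | P ) F" := (\big[Rplus/0]_(i : t | P%B) F) (only parsing) : R_scope.
Local Notation "\sum_ ( i < n ) F" := (\big[Rplus/0]_(i < n) F) : R_scope.
Local Notation "\prod_ ( i | P ) F" := (\big[Rmult/1]_(i | P%B) F) : R_scope.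
Local Notation "\prod_ i F" := (\big[Rmult/1]_i F) : R_scope.
Local Notation "\prod_ ( i : t ) F" := (\big[Rmult/1]_(i : t) F) (only parsing) : R_scope.

(** * Finite sums *)

Lemma RlebP (a b : R) : reflect (a <= b) (Rleb a b).
Proof. by rewrite /Rleb; case: Rle_dec => h; constructor. Qed.

Lemma RltbP (a b : R) : reflect (a < b) (Rltb a b).
Proof. by rewrite /Rltb; case: Rlt_dec => h; constructor. Qed.

Section SumLemmas.
Variables (I : Type) (r : seq I).
Implicit Types (P : pred I) (F G : I -> R).

Lemma Rsum_ge0 P F : (forall i, P i -> 0 <= F i) -> 0 <= \sum_(i <- r | P i) F i.
Proof. by move=> h; elim/big_ind: _ => // *; lra. Qed.

Lemma Rsum_le P F G : (forall i, P i -> F i <= G i) ->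
  \sum_(i <- r | P i) F i <= \sum_(i <- r | P i) G i.
Proof. by move=> h; elim/big_ind2: _ => // *; lra. Qed.

Lemma Rsum_subpred P1 P2 F : (forall i, P1 i -> P2 i) -> (forall i, 0 <= F i) ->
  \sum_(i <- r | P1 i) F i <= \sum_(i <- r | P2 i) F i.
Proof.
move=> s h; rewrite big_mkcond [X in _ <= X]big_mkcond; apply: Rsum_le => i _.
by case: ifP => [/s ->|_]; [lra | case: ifP => _ //; lra].
Qed.

Lemma Rsum_opp P F : \sum_(i <- r | P i) - F i = - \sum_(i <- r | P i) F i.
Proof. by elim/big_rec2: _ => [|i y1 y2 _ ->]; lra. Qed.

Lemma Rsum_sub P F G : \sum_(i <- r | P i) (F i - G i) =
  \sum_(i <- r | P i) F i - \sum_(i <- r | P i) G i.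
Proof. by rewrite big_split /= Rsum_opp. Qed.

Lemma Rsum_mulr P F c : \sum_(i <- r | P i) (F i * c) = (\sum_(i <- r | P i) F i) * c.
Proof. by rewrite big_distrl. Qed.

Lemma Rsum_mull P F c : \sum_(i <- r | P i) (c * F i) = c * \sum_(i <- r | P i) F i.
Proof. by rewrite big_distrr. Qed.

Lemma Rprod_ge0 P F : (forall i, P i -> 0 <= F i) -> 0 <= \big[Rmult/1]_(i <- r | P i) F i.
Proof. by move=> h; elim/big_ind: _ => //; [lra | exact: Rmult_le_pos]. Qed.

Lemma Rprod_gt0 P F : (forall i, P i -> 0 < F i) -> 0 < \big[Rmult/1]_(i <- r | P i) F i.
Proof. by move=> h; elim/big_ind: _ => //; [lra | exact: Rmult_lt_0_compat]. Qed.

Lemma ln_prod P F : (forall i, P i -> 0 < F i) ->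
  ln (\big[Rmult/1]_(i <- r | P i) F i) = \sum_(i <- r | P i) ln (F i).
Proof.
move=> h.
suff: 0 < \big[Rmult/1]_(i <- r | P i) F i /\
  ln (\big[Rmult/1]_(i <- r | P i) F i) = \sum_(i <- r | P i) ln (F i) by case.
elim/big_ind2: _ => [|x1 x2 y1 y2 [h1 e1] [h2 e2]|i Pi].
- by split; [lra | exact: ln_1].
- by split; [exact: Rmult_lt_0_compat | rewrite ln_mult // e1 e2].
- by split; [exact: h|].
Qed.
End SumLemmas.

Lemma Rsum_ge_term (I : finType) (P : pred I) (F : I -> R) (i : I) :
  P i -> (forall i, P i -> 0 <= F i) -> F i <= \sum_(i | P i) F i.
Proof.
move=> Pi h; rewrite (bigD1 i) //=.
suff : 0 <= \sum_(j | P j && (j != i)) F j by lra.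
by apply: Rsum_ge0 => j /andP[/h].
Qed.

Lemma Rsum_const (I : finType) (c : R) : \sum_(i : I) c = INR #|I| * c.
Proof.
rewrite big_const; elim: #|I| => [|n IH]; first by rewrite /=; lra.
by rewrite iterS IH S_INR; lra.
Qed.

Lemma Rsum_ffun_prod (I J : finType) (F : I -> J -> R) :
  \sum_(f : {ffun I -> J}) \prod_i F i (f i) = \prod_i \sum_j F i j.
Proof. by rewrite bigA_distr_bigA. Qed.

(** * Marginals and relative entropy *)

Definition marg (W A : finType) (P : W -> R) (phi : W -> A) (a : A) : R :=
  \sum_(w | phi w == a) P w.

(* Minus the entropy of the observable [phi]. *)
Definition Elog (W A : finType) (P : W -> R) (phi : W -> A) : R :=
  \sum_w P w * ln (marg P phi (phi w)).

Definition kl (T : finType) (P Q : T -> R) : R := \sum_i P i * ln (P i / Q i).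

Section Marginals.
Variables (W : finType) (P : W -> R).
Hypothesis P0 : forall w, 0 <= P w.

Lemma marg_ge0 (A : finType) (phi : W -> A) a : 0 <= marg P phi a.
Proof. exact: Rsum_ge0. Qed.

Lemma marg_gt0 (A : finType) (phi : W -> A) w : 0 < P w -> 0 < marg P phi (phi w).
Proof.
move=> h; apply: Rlt_le_trans h _.
by apply: (Rsum_ge_term (F := P) (P := fun v => phi v == phi w)).
Qed.

Lemma sum_marg (A : finType) (phi : W -> A) (F : A -> R) :
  \sum_w P w * F (phi w) = \sum_a marg P phi a * F a.
Proof.
rewrite (partition_big phi xpredT) //=; apply: eq_bigr => a _.
by rewrite /marg big_distrl /=; apply: eq_bigr => w /eqP ->.
Qed.

Lemma sum_marg_pred (A : finType) (phi : W -> A) (E : pred A) :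
  \sum_(a | E a) marg P phi a = \sum_(w | E (phi w)) P w.
Proof.
rewrite big_mkcond [RHS]big_mkcond /=.
have := sum_marg phi (fun a => if E a then 1 else 0).
rewrite (eq_bigr (fun w => if E (phi w) then P w else 0)); last first.
  by move=> w _; case: ifP; lra.
by move=> ->; apply: eq_bigr => a _; case: ifP; lra.
Qed.

Lemma marg_sum (A : finType) (phi : W -> A) : \sum_a marg P phi a = \sum_w P w.
Proof. exact: sum_marg_pred. Qed.

Lemma marg_comp (A B : finType) (phi : W -> A) (h : A -> B) b :
  marg P (h \o phi) b = \sum_(a | h a == b) marg P phi a.
Proof. by rewrite (sum_marg_pred phi (fun a => h a == b)). Qed.

Lemma marg_key (A B : finType) (phi : W -> A) (psi : W -> B) w :
  (forall v v', (phi v == phi v') = (psi v == psi v')) ->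
  marg P phi (phi w) = marg P psi (psi w).
Proof. by move=> h; apply: eq_bigl => v; rewrite h. Qed.

(** Entropy depends only on the partition that an observable induces, so observables are
    interchanged by comparing which points they identify. *)
Lemma Elog_key (A B : finType) (phi : W -> A) (psi : W -> B) :
  (forall v v', (phi v == phi v') = (psi v == psi v')) -> Elog P phi = Elog P psi.
Proof. by move=> h; apply: eq_bigr => w _; rewrite (marg_key _ h). Qed.

End Marginals.

Lemma ln_div (x y : R) : 0 < x -> 0 < y -> ln (x / y) = ln x - ln y.
Proof.
by move=> x0 y0; rewrite /Rdiv ln_mult ?ln_Rinv //; exact: Rinv_0_lt_compat.
Qed.

Lemma ln_ge_1sub (x : R) : 0 < x -> 1 - / x <= ln x.
Proof.
move=> x0; have h := exp_ineq1_le (- ln x).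
by move: h; rewrite exp_Ropp exp_ln //; lra.
Qed.

(* Donsker--Varadhan with the test function [lam * 1_E], linearised by [ln u <= u - 1]. *)
Lemma kl_event (T : finType) (P Q : T -> R) (E : pred T) (lam : R) :
  (forall i, 0 <= P i) -> (forall i, 0 <= Q i) ->
  (forall i, 0 < P i -> 0 < Q i) ->
  \sum_i P i = 1 -> \sum_i Q i <= 1 ->
  lam * \sum_(i | E i) P i <= kl P Q + (exp lam - 1) * \sum_(i | E i) Q i.
Proof.
move=> P0 Q0 ac P1 Q1.
have pt i : P i * (if E i then lam else 0) + P i
            - Q i * (if E i then exp lam else 1) <= P i * ln (P i / Q i).
  set phi := if E i then lam else 0.
  have -> : (if E i then exp lam else 1) = exp phi.
    by rewrite /phi; case: ifP => _ //; rewrite exp_0.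
  case: (Rle_lt_or_eq_dec _ _ (P0 i)) => [Pi|<-]; last first.
    by have := Rmult_le_pos _ _ (Q0 i) (Rlt_le _ _ (exp_pos phi)); lra.
  have Qi := ac _ Pi; have e0 := exp_pos phi.
  have := @ln_ge_1sub (P i / (Q i * exp phi)).
  have -> : / (P i / (Q i * exp phi)) = Q i * exp phi / P i by field; lra.
  have pos : 0 < Q i * exp phi by exact: Rmult_lt_0_compat.
  rewrite ln_div // ln_mult // ln_exp ln_div // => h.
  have {}h := h (Rdiv_lt_0_compat _ _ Pi pos).
  have := Rmult_le_compat_l _ _ _ (P0 i) h.
  have -> : P i * (1 - Q i * exp phi / P i) = P i - Q i * exp phi by field; lra.
  by move=> *; lra.
have s : \sum_i (P i * (if E i then lam else 0) + P i
            - Q i * (if E i then exp lam else 1)) <= kl P Q.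
  by apply: Rsum_le.
move: s; rewrite Rsum_sub big_split /= P1.
have -> : \sum_i P i * (if E i then lam else 0) = lam * \sum_(i | E i) P i.
  by rewrite -Rsum_mull [RHS]big_mkcond; apply: eq_bigr => i _; case: ifP; lra.
have -> : \sum_i Q i * (if E i then exp lam else 1) =
          \sum_i Q i + (exp lam - 1) * \sum_(i | E i) Q i.
  rewrite -Rsum_mull [X in _ + X]big_mkcond -big_split /=.
  by apply: eq_bigr => i _; case: ifP; lra.
lra.
Qed.

Lemma kl_ge0 (T : finType) (P Q : T -> R) :
  (forall i, 0 <= P i) -> (forall i, 0 <= Q i) ->
  (forall i, 0 < P i -> 0 < Q i) ->
  \sum_i P i = 1 -> \sum_i Q i <= 1 -> 0 <= kl P Q.
Proof.
move=> P0 Q0 ac P1 Q1; have := kl_event xpredT 0 P0 Q0 ac P1 Q1.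
by rewrite exp_0; lra.
Qed.

(** * Gibbs' inequality and submodularity of entropy *)

Section Entropy.
Variables (W : finType) (P : W -> R).
Hypothesis P0 : forall w, 0 <= P w.
Hypothesis P1 : \sum_w P w = 1.

Lemma kl_marg (A : finType) (phi : W -> A) (q : A -> R) :
  kl (marg P phi) q = \sum_w P w * ln (marg P phi (phi w) / q (phi w)).
Proof. by rewrite (sum_marg P phi (fun a => ln (marg P phi a / q a))). Qed.

Lemma gt0_of_marg (A : finType) (phi : W -> A) a :
  0 < marg P phi a -> exists2 w, phi w = a & 0 < P w.
Proof.
move=> h; case: (pickP [pred w | (phi w == a) && Rltb 0 (P w)]) => [w /andP[/eqP e /RltbP]|no].
  by exists w.
exfalso; move: h; rewrite /marg big1 => [|w e]; first lra.
by move: (no w); rewrite /= e /=; have := P0 w; case: RltbP => //; lra.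
Qed.

Lemma kl_margE (A : finType) (phi : W -> A) (q : A -> R) :
  (forall w, 0 < P w -> 0 < q (phi w)) ->
  kl (marg P phi) q = Elog P phi - \sum_w P w * ln (q (phi w)).
Proof.
move=> h; rewrite kl_marg -Rsum_sub; apply: eq_bigr => w _.
case: (Rle_lt_or_eq_dec _ _ (P0 w)) => [Pw|<-]; last lra.
by rewrite ln_div; [lra | exact: marg_gt0 | exact: h].
Qed.

Lemma kl_marg_ge0 (A : finType) (phi : W -> A) (q : A -> R) :
  (forall a, 0 <= q a) -> \sum_a q a <= 1 ->
  (forall w, 0 < P w -> 0 < q (phi w)) -> 0 <= kl (marg P phi) q.
Proof.
move=> q0 q1 ac; apply: kl_ge0 => //; first exact: marg_ge0.
- by move=> a /gt0_of_marg [w <-]; exact: ac.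
- by rewrite marg_sum.
Qed.

(** Gibbs' inequality: any explicit model [q] of the law of [phi] bounds minus its entropy from
    below. It is applied below to models of product form. *)
Lemma gibbs (A : finType) (phi : W -> A) (q : A -> R) :
  (forall a, 0 <= q a) -> \sum_a q a <= 1 ->
  (forall w, 0 < P w -> 0 < q (phi w)) ->
  \sum_w P w * ln (q (phi w)) <= Elog P phi.
Proof.
move=> q0 q1 ac; have := kl_marg_ge0 q0 q1 ac; rewrite kl_margE //; lra.
Qed.

(** Gibbs' inequality against [p1 * p2 / p0], the law under which [psi] and [chi] are independent
    given [phi]. *)
Lemma Elog_submodular (A B C : finType) (phi : W -> A) (psi : W -> B) (chi : W -> C) :
  Elog P (fun w => (phi w, psi w)) + Elog P (fun w => (phi w, chi w)) <=
  Elog P phi + Elog P (fun w => (phi w, psi w, chi w)).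
Proof.
pose p1 := marg P (fun w => (phi w, psi w)); pose p2 := marg P (fun w => (phi w, chi w)).
pose p0 := marg P phi.
pose q (u : A * B * C) := p1 u.1 * p2 (u.1.1, u.2) / p0 u.1.1.
have p10 := marg_ge0 P0 (fun w => (phi w, psi w)).
have p20 := marg_ge0 P0 (fun w => (phi w, chi w)).
have p00 := marg_ge0 P0 phi.
have i0 a : 0 <= / p0 a.
  by case: (Rle_lt_or_eq_dec _ _ (p00 a)) => [/Rinv_0_lt_compat|] h;
     [exact: Rlt_le | rewrite /p0 -h Rinv_0; lra].
have E1 a : \sum_b p1 (a, b) = p0 a.
  rewrite /p0 /p1 (marg_comp P (fun w => (phi w, psi w)) (@fst A B)).
  rewrite (eq_bigl (fun u => (u.1 == a) && (u.2 \in B))) => [|u]; last by rewrite andbT.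
  by rewrite -(pair_big (fun i => i == a) xpredT (fun i j => p1 (i, j))) /= big_pred1_eq.
have E2 a : \sum_c p2 (a, c) = p0 a.
  rewrite /p0 /p2 (marg_comp P (fun w => (phi w, chi w)) (@fst A C)).
  rewrite (eq_bigl (fun u => (u.1 == a) && (u.2 \in C))) => [|u]; last by rewrite andbT.
  by rewrite -(pair_big (fun i => i == a) xpredT (fun i j => p2 (i, j))) /= big_pred1_eq.
have qs : \sum_u q u <= 1.
  rewrite -(pair_big xpredT xpredT (fun u c => q (u, c))) /=.
  rewrite -(pair_big xpredT xpredT (fun a b => \sum_c q (a, b, c))) /=.
  rewrite -P1 -(marg_sum P phi); apply: Rsum_le => a _.
  have -> : \sum_b \sum_c q (a, b, c) = p0 a * p0 a / p0 a.
    rewrite -{1}(E1 a) -{1}(E2 a) /Rdiv -!Rsum_mulr; apply: eq_bigr => b _.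
    by rewrite -Rsum_mull -Rsum_mulr.
  case: (Req_dec (p0 a) 0) => [->|n0]; first by rewrite Rmult_0_l /Rdiv Rmult_0_l; exact: marg_ge0.
  by right; rewrite -/(p0 a); field.
have := @gibbs _ (fun w => (phi w, psi w, chi w)) q _ qs _.
have pp w (h : 0 < P w) := (marg_gt0 P0 phi h, marg_gt0 P0 (fun w => (phi w, psi w)) h,
   marg_gt0 P0 (fun w => (phi w, chi w)) h).
have q0 u : 0 <= q u by apply: Rmult_le_pos; [exact: Rmult_le_pos | exact: i0].
have qp w : 0 < P w -> 0 < q (phi w, psi w, chi w).
  by move=> /pp [[h0 h1] h2]; apply: Rdiv_lt_0_compat => //=; apply: Rmult_lt_0_compat.
move=> /(_ q0 qp) h.
suff e : \sum_w P w * ln (q (phi w, psi w, chi w)) =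
  Elog P (fun w => (phi w, psi w)) + Elog P (fun w => (phi w, chi w)) - Elog P phi by lra.
rewrite /Elog -big_split -Rsum_sub /=; apply: eq_bigr => w _.
case: (Rle_lt_or_eq_dec _ _ (P0 w)) => [/pp [[h0 h1] h2]|<-]; last lra.
by rewrite /q /= ln_div ?ln_mult //; [rewrite /p1 /p2 /p0; lra | exact: Rmult_lt_0_compat].
Qed.

End Entropy.

(** * Random rectangles *)

Lemma exp_le_compat (x y : R) : x <= y -> exp x <= exp y.
Proof. by case=> [/exp_increasing|->]; [exact: Rlt_le | exact: Rle_refl]. Qed.

Section RandomRectangles.
Variables (X Y Q : finType) (q : Q -> R) (a : Q -> X -> bool) (b : Q -> Y -> bool).
Hypothesis q0 : forall i, 0 <= q i.

(* Each point [i] is selected independently with probability [1 - exp (- q i)], so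
   that the probability of missing a set of points is [exp] of minus its weight. *)
Definition coin (i : Q) (c : bool) : R := if c then 1 - exp (- q i) else exp (- q i).
Arguments coin : simpl never.
Definition wt (h : {ffun Q -> bool}) : R := \prod_i coin i (h i).

Lemma coin_ge0 i c : 0 <= coin i c.
Proof.
rewrite /coin; case: c; last exact/Rlt_le/exp_pos.
have : exp (- q i) <= exp 0 by apply: exp_le_compat; have := q0 i; lra.
by rewrite exp_0; lra.
Qed.

Lemma coin_le i : coin i true <= q i.
Proof. by rewrite /coin; have := exp_ineq1_le (- q i); lra. Qed.

Lemma coin_sum i : \sum_c coin i c = 1.
Proof. by rewrite big_bool /coin /=; lra. Qed.

Lemma wt_ge0 h : 0 <= wt h.
Proof. by apply: Rprod_ge0 => i _; exact: coin_ge0. Qed.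

Lemma wt_family (S : Q -> pred bool) :
  \sum_(h : {ffun Q -> bool} | [forall i, S i (h i)]) wt h = \prod_i \sum_(c | S i c) coin i c.
Proof.
rewrite bigA_distr_big_dep; apply: eq_bigl => h.
by apply/forallP/familyP => H i; have := H i.
Qed.

Lemma wt_sum1 : \sum_h wt h = 1.
Proof. by rewrite Rsum_ffun_prod big1 // => i _; exact: coin_sum. Qed.

Lemma wt_all (c : bool) (D : pred Q) :
  \sum_(h : {ffun Q -> bool} | [forall i, D i ==> (h i == c)]) wt h = \prod_(i | D i) coin i c.
Proof.
rewrite (wt_family (fun i e => D i ==> (e == c))) [RHS]big_mkcond /=.
apply: eq_bigr => i _; case: (D i) => /=; first exact: big_pred1_eq.
exact: coin_sum.
Qed.

(** Distinct points are selected independently, each with probability [1 - exp (- q i) <= q i]. *)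
Lemma wt_pair i j : \sum_(h : {ffun Q -> bool} | h i && h j) wt h <=
  if i == j then q i else q i * q j.
Proof.
have -> : \sum_(h : {ffun Q -> bool} | h i && h j) wt h =
          \prod_(k | (k == i) || (k == j)) coin k true.
  rewrite -wt_all; apply: eq_bigl => h; apply/andP/forallP => [[hi hj] k|H].
    by apply/implyP => /orP[/eqP->|/eqP->]; rewrite ?hi ?hj.
  by have := H i; have := H j; rewrite !eqxx orbT /= => /eqP-> /eqP->.
case: eqP => [<-|/eqP ne].
  by rewrite (big_pred1 i) => [|k]; [exact: coin_le | rewrite /= orbb].
rewrite (bigD1 i) ?eqxx //= (eq_bigl (pred1 j)) => [|k].
  by rewrite big_pred1_eq; apply: Rmult_le_compat;
     [exact: coin_ge0 | exact: coin_ge0 | exact: coin_le | exact: coin_le].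
by rewrite /=; case: (k =P i) => [->|]; rewrite ?andbF ?andbT //= (negbTE ne).
Qed.

(** An input enters its side as soon as it accepts some selected point; the two players need not
    accept the same one, which is what makes the set a rectangle. *)
Definition rect_of (h : {ffun Q -> bool}) : {set X} * {set Y} :=
  ([set x | [exists i, h i && a i x]], [set y | [exists i, h i && b i y]]).

(** Union bound over pairs of selected points, one accepted by [x] and one by [y]: a common point
    accounts for the first term, two distinct points for the product. *)
Lemma rect_prob_le x y : \sum_(h | in_rect (rect_of h) (x, y)) wt h <=
  \sum_(i | a i x && b i y) q i + (\sum_(i | a i x) q i) * (\sum_(j | b j y) q j).
Proof.
apply: Rle_trans (_ : _ <= \sum_(i | a i x) \sum_(j | b j y)
   \sum_(h : {ffun Q -> bool} | h i && h j) wt h) _.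
  have -> : \sum_(i | a i x) \sum_(j | b j y) \sum_(h : {ffun Q -> bool} | h i && h j) wt h =
     \sum_(h : {ffun Q -> bool}) \sum_(i | a i x) \sum_(j | b j y) (if h i && h j then wt h else 0).
    rewrite [RHS]exchange_big /=; apply: eq_bigr => i _.
    by rewrite [RHS]exchange_big /=; apply: eq_bigr => j _; rewrite big_mkcond.
  rewrite big_mkcond; apply: Rsum_le => h _.
  have w0 := wt_ge0 h.
  case: ifP => [|_]; last by do 2![apply: Rsum_ge0 => ? _]; case: ifP; lra.
  rewrite /in_rect !inE /= => /andP[/existsP[i /andP[hi ai]] /existsP[j /andP[hj bj]]].
  apply: (Rle_trans _ (\sum_(j | b j y) (if h i && h j then wt h else 0))); last first.
    apply: (Rsum_ge_term (F := fun i => \sum_(j | b j y) (if h i && h j then wt h else 0))) => // k _.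
    by apply: Rsum_ge0 => ? _; case: ifP; lra.
  apply: (Rle_trans _ (if h i && h j then wt h else 0)); first by rewrite hi hj /=; lra.
  apply: (Rsum_ge_term (F := fun j => (if h i && h j then wt h else 0))) => // k _.
  by case: ifP; lra.
apply: Rle_trans (_ : _ <= \sum_(i | a i x) \sum_(j | b j y) (if i == j then q i else q i * q j)) _.
  by do 2![apply: Rsum_le => ? _]; exact: wt_pair.
rewrite -Rsum_mulr [X in _ <= X + _]big_mkcondr -big_split /=; apply: Rsum_le => i _.
rewrite -Rsum_mull.
have -> : (if b i y then q i else 0) = \sum_(j | b j y) (if i == j then q i else 0).
  rewrite -big_mkcondr; case: ifP => bi.
    by rewrite (big_pred1 i) // => j /=; case: eqP => [<-|]; rewrite ?andbF ?eqxx ?bi //;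
       move=> ne; apply/esym/eqP => e; apply: ne.
  by rewrite big_pred0 // => j; case: eqP => [<-|]; rewrite ?andbF ?bi.
rewrite -big_split; apply: Rsum_le => j _ /=.
by have := Rmult_le_pos _ _ (q0 i) (q0 j); case: ifP; lra.
Qed.

(** One selected point accepted by both inputs suffices, and some such point is selected with
    probability [1 - exp (- K)]. *)
Lemma rect_prob_ge x y : let K := \sum_(i | a i x && b i y) q i in
  K * (1 - K) <= \sum_(h | in_rect (rect_of h) (x, y)) wt h.
Proof.
move=> K; have K0 : 0 <= K by exact: Rsum_ge0.
(* Uses [exp (- K) <= / (1 + K) <= 1 - K + K * K]. *)
apply: (Rle_trans _ (1 - exp (- K))).
  have h := exp_ineq1_le K; have e0 := exp_pos K.
  rewrite exp_Ropp.
  have : / exp K <= / (1 + K) by apply: Rinv_le_contravar; lra.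
  have : / (1 + K) <= 1 - K + K * K.
    apply: (Rmult_le_reg_l (1 + K)); first lra.
    by rewrite Rinv_r; nra.
  by nra.
pose miss (h : {ffun Q -> bool}) := [forall i, (a i x && b i y) ==> (h i == false)].
have -> : exp (- K) = \sum_(h | miss h) wt h.
  rewrite wt_all /coin /K -Rsum_opp.
  by elim/big_rec2: _ => [|i y1 y2 _ <-]; rewrite ?exp_0 ?exp_plus.
have e : 1 = \sum_(h | miss h) wt h + \sum_(h | ~~ miss h) wt h.
  by rewrite -wt_sum1 (bigID miss).
apply: Rle_trans (_ : _ <= \sum_(h | ~~ miss h) wt h) _; first lra.
apply: Rsum_subpred wt_ge0 => h; rewrite negb_forall => /existsP[i].
rewrite negb_imply eqbF_neg negbK => /andP[/andP[ai bi] hi].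
by rewrite /in_rect !inE; apply/andP; split; apply/existsP; exists i; rewrite hi.
Qed.

(** The hypothesis on rectangles is linear in the rectangle, hence survives averaging over the
    random one. Its expected measure is bounded below by [rect_prob_ge] and its expected measure
    inside [E] above by [rect_prob_le]. *)
Lemma random_rectangle (mu : X * Y -> R) (E : pred (X * Y)) (e0 sig L : R) :
  (forall u, 0 <= mu u) -> \sum_u mu u = 1 -> 0 <= e0 -> 0 <= L ->
  (forall x, \sum_(i | a i x) q i <= L) -> (forall y, \sum_(i | b i y) q i <= L) ->
  (forall AB, e0 * (prob mu (in_rect AB) - sig) <=
              prob mu (fun u => in_rect AB u && E u)) ->
  let K u := \sum_(i | a i u.1 && b i u.2) q i in
  e0 * ((1 - L) * (\sum_u mu u * K u) - sig) <= \sum_(u | E u) mu u * K u + L * L.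
Proof.
move=> mu0 mu1 e00 L0 aL bL rect K.
have : \sum_h wt h * (e0 * (prob mu (in_rect (rect_of h)) - sig)) <=
       \sum_h wt h * prob mu (fun u => in_rect (rect_of h) u && E u).
  by apply: Rsum_le => h _; apply: Rmult_le_compat_l; [exact: wt_ge0 | exact: rect].
have avg (F : pred (X * Y)) :
    \sum_h wt h * prob mu (fun u => in_rect (rect_of h) u && F u) =
    \sum_(u | F u) mu u * \sum_(h | in_rect (rect_of h) u) wt h.
  rewrite /prob; under eq_bigr => h _ do rewrite -Rsum_mull big_mkcond.
  rewrite exchange_big [RHS]big_mkcond /=; apply: eq_bigr => u _.
  case: (F u); last by rewrite big1 // => h _; rewrite andbF.
  by rewrite -Rsum_mull [RHS]big_mkcond; apply: eq_bigr => h _; rewrite andbT; case: ifP; lra.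
have -> : \sum_h wt h * (e0 * (prob mu (in_rect (rect_of h)) - sig)) =
   e0 * (\sum_h wt h * prob mu (fun u => in_rect (rect_of h) u && xpredT u) - sig).
  rewrite -{2}(Rmult_1_l sig) -wt_sum1 -Rsum_mulr -Rsum_sub -Rsum_mull; apply: eq_bigr => h _.
  have -> : prob mu (fun u => in_rect (rect_of h) u && xpredT u) = prob mu (in_rect (rect_of h)).
    by apply: eq_bigl => u; rewrite andbT.
  by lra.
rewrite !avg => main.
have lo : (1 - L) * (\sum_u mu u * K u) <=
          \sum_u mu u * \sum_(h | in_rect (rect_of h) u) wt h.
  rewrite -Rsum_mull; apply: Rsum_le => -[x y] _.
  have := rect_prob_ge x y; rewrite /= -/(K (x, y)) => h.
  have KL : K (x, y) <= L.
    apply: Rle_trans (aL x).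
    by apply: Rsum_subpred q0 => i /andP[].
  have K0 : 0 <= K (x, y) by exact: Rsum_ge0.
  have m0 := mu0 (x, y).
  have : K (x, y) * (1 - L) <= K (x, y) * (1 - K (x, y)) by apply: Rmult_le_compat_l; lra.
  move=> h2; rewrite (Rmult_comm (1 - L)) Rmult_assoc; apply: Rmult_le_compat_l => //; lra.
have hi : \sum_(u | E u) mu u * \sum_(h | in_rect (rect_of h) u) wt h <=
          \sum_(u | E u) mu u * K u + L * L.
  apply: Rle_trans (_ : _ <= \sum_(u | E u) (mu u * K u + mu u * (L * L))) _.
    apply: Rsum_le => -[x y] _; rewrite -Rmult_plus_distr_l.
    apply: Rmult_le_compat_l => //; apply: Rle_trans (rect_prob_le x y) _.
    apply: Rplus_le_compat_l; apply: Rmult_le_compat => //; exact: Rsum_ge0.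
  rewrite big_split /= Rsum_mulr.
  have : \sum_(u | E u) mu u <= 1 by rewrite -mu1; exact: Rsum_subpred.
  move=> h; apply: Rplus_le_compat_l; rewrite -[X in _ <= X]Rmult_1_l.
  by apply: Rmult_le_compat_r h; exact: Rmult_le_pos.
have := Rmult_le_compat_l e0 _ _ e00 lo; lra.
Qed.

End RandomRectangles.

(** * Layer-cake decomposition of nonnegative functions *)

Section LayerCake.

(** Each level is paired with its gap from the preceding level, the latter being [v] for the first
    one. *)
Fixpoint layers (v : R) (s : seq R) : seq (R * R) :=
  if s is u :: s' then (u - v, u) :: layers u s' else [::].

Lemma layers_ge0 v s : path Rleb v s -> forall l, List.In l (layers v s) -> 0 <= l.1.
Proof.
elim: s v => [|u s IH] v //= /andP[/RlebP vu pu] l [<-|]; first by rewrite /=; lra.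
exact: IH.
Qed.

Lemma layers_below v s c : path Rleb v s -> c < v ->
  \sum_(l <- layers v s | Rleb l.2 c) l.1 = 0.
Proof.
elim: s v => [|u s IH] v /=; first by rewrite big_nil.
move=> /andP[/RlebP vu pu] cv; rewrite big_cons /=.
by case: RlebP => [|_]; [lra | apply: IH => //; lra].
Qed.

Lemma layers_sum v s c : path Rleb v s -> List.In c (v :: s) ->
  \sum_(l <- layers v s | Rleb l.2 c) l.1 = c - v.
Proof.
elim: s v => [|u s IH] v /=; first by rewrite big_nil => _ [->|//]; lra.
move=> /andP[/RlebP vu pu] H; rewrite big_cons /=.
case: RlebP => [uc|nuc].
  case: H => [e|H]; last by rewrite IH //; lra.
  have eq : u = c by lra.
  by rewrite IH //; [lra | left].
case: H => [e|H]; first by rewrite layers_below //; lra.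
have : u <= c; last by lra.
have : List.In c (u :: s) by [].
elim: (s) (u) pu {IH H vu nuc} => [|w s' IH] u' /=; first by move=> _ [->|//]; lra.
move=> /andP[/RlebP uw pw] [->|H]; first lra.
by have := IH _ pw H; lra.
Qed.

End LayerCake.

Lemma Rleb_total : total Rleb.
Proof.
by move=> x y; case: (RlebP x y) => // h; case: (RlebP y x) => //; lra.
Qed.

(** The levels are the sorted values of [h], weighted by their gaps, which telescope. One family of
    levels serves all points [v]. *)
Lemma layer_cake (V : finType) (h : V -> R) : (forall v, 0 <= h v) ->
  exists n (w th : 'I_n -> R), (forall i, 0 <= w i) /\
    forall v, \sum_(i | Rleb (th i) (h v)) w i = h v.
Proof.
move=> h0.
pose s := [seq h v | v <- sort (fun u v => Rleb (h u) (h v)) (enum V)].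
have ps : path Rleb 0 s.
  have : sorted Rleb s.
    rewrite sorted_map; apply: sort_sorted => u v; exact: Rleb_total.
  have : forall u, List.In u s -> 0 <= u.
    by rewrite /s => u /List.in_map_iff [v [<- _]].
  case: (s) => //= u s' H ->; rewrite andbT; apply/RlebP; apply: H; by left.
have ins v : List.In (h v) (0 :: s).
  right; apply/List.in_map_iff; exists v; split => //.
  have : v \in sort (fun u v => Rleb (h u) (h v)) (enum V) by rewrite mem_sort mem_enum.
  by elim: (sort _ _) => //= u s' IH; rewrite inE => /orP[/eqP->|/IH]; [left | right].
pose l := layers 0 s; pose d := (0, 0).
exists (size l), (fun i => (nth d l i).1), (fun i => (nth d l i).2); split=> [i|v].
  apply: (layers_ge0 ps); rewrite -/l.
  have : (i < size l)%N by [].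
  elim: (l) (nat_of_ord i) => //= x l' IH [|k] //=; first by left.
  by move=> ?; right; apply: IH.
have := layers_sum ps (ins v); rewrite -/l (big_nth d) big_mkord => ->; lra.
Qed.

(** * Sampling a transcript without communication *)

Lemma Rsum_triple (T I J : finType) (lab : pred T) (c : R) (w : I -> R) (w' : J -> R)
    (D1 : T -> pred I) (D2 : T -> pred J) :
  \sum_(u : T * I * J | D1 u.1.1 u.1.2 && D2 u.1.1 u.2)
     (if lab u.1.1 then c * (w u.1.2 * w' u.2) else 0) =
  \sum_(o | lab o) c * ((\sum_(i | D1 o i) w i) * (\sum_(j | D2 o j) w' j)).
Proof.
pose F o i j := if D1 o i && D2 o j then if lab o then c * (w i * w' j) else 0 else 0.
transitivity (\sum_o \sum_i \sum_j F o i j).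
  rewrite pair_big pair_big /= big_mkcond; by apply: eq_bigr => -[[o i] j].
rewrite [RHS]big_mkcond; apply: eq_bigr => o _; rewrite /F.
case: (lab o); last by rewrite big1 // => i _; rewrite big1 // => j _; case: ifP.
rewrite -Rsum_mulr -Rsum_mull [RHS]big_mkcond; apply: eq_bigr => i _.
case: (D1 o i) => /=; last by rewrite big1.
by rewrite -!Rsum_mull [RHS]big_mkcond.
Qed.

(** The sets of levels below [u] and below [v] are nested, so their intersection is the smaller of
    the two. *)
Lemma layer_min (n : nat) (w th : 'I_n -> R) (u v : R) :
  \sum_(i | Rleb (th i) u) w i = u -> \sum_(i | Rleb (th i) v) w i = v ->
  \sum_(i | Rleb (th i) u && Rleb (th i) v) w i = Rmin u v.
Proof.
move=> hu hv; rewrite /Rmin; case: Rle_dec => h; [rewrite -{2}hu | rewrite -{2}hv];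
  apply: eq_bigl => i; case: (RlebP (th i) u) => h1; case: (RlebP (th i) v) => h2 //=; lra.
Qed.

Lemma Rdiv_ge0 (x y : R) : 0 <= x -> 0 <= y -> 0 <= x / y.
Proof.
move=> x0 [y0|<-]; last by rewrite /Rdiv Rinv_0; lra.
by apply: Rmult_le_pos => //; exact/Rlt_le/Rinv_0_lt_compat.
Qed.

Lemma Rmult_div_le (x y : R) : 0 <= y -> x * (y / x) <= y.
Proof.
move=> y0; case: (Req_dec x 0) => [->|n0]; first by rewrite Rmult_0_l.
by right; field.
Qed.

(* [uA o x * uB o y] is the density of the transcript [o]; Alice, who knows [x], guesses
   [QB x o / uA o x] for Bob's factor, and Bob guesses [QA y o / uB o y] for Alice's.
   A point of the transcript [o] is a pair of levels, the first one below Alice's factor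
   and the second one below Bob's factor; a player replaces the factor that she does not
   know by [L] times her guess. *)
Lemma zero_communication (X Y T : finType) (mu : X * Y -> R) (uA : T -> X -> R)
    (uB : T -> Y -> R) (QA : Y -> T -> R) (QB : X -> T -> R) (lab : pred T)
    (E : pred (X * Y)) (e0 sig L p : R) :
  (forall u, 0 <= mu u) -> \sum_u mu u = 1 ->
  (forall o x, 0 <= uA o x) -> (forall o y, 0 <= uB o y) ->
  (forall y o, 0 <= QA y o) -> (forall x o, 0 <= QB x o) ->
  (forall y, \sum_o QA y o <= 1) -> (forall x, \sum_o QB x o <= 1) ->
  0 <= e0 -> 0 <= L -> 0 <= p -> p * L <= 1 ->
  (forall AB, e0 * (prob mu (in_rect AB) - sig) <=
              prob mu (fun u => in_rect AB u && E u)) ->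
  let dens u o := uA o u.1 * uB o u.2 in
  let good u o := Rleb (dens u o) (L * QA u.2 o) && Rleb (dens u o) (L * QB u.1 o) in
  e0 * ((1 - p * L) * (p * \sum_u mu u * \sum_(o | lab o && good u o) dens u o) - sig) <=
  p * (\sum_(u | E u) mu u * \sum_(o | lab o) dens u o) + (p * L) * (p * L).
Proof.
move=> mu0 mu1 uA0 uB0 QA0 QB0 QA1 QB1 e00 L0 p0 pL rect dens good.
pose vA o y := L * (QA y o / uB o y); pose vB o x := L * (QB x o / uA o x).
have vA0 o y : 0 <= vA o y by apply: Rmult_le_pos => //; exact: Rdiv_ge0.
have vB0 o x : 0 <= vB o x by apply: Rmult_le_pos => //; exact: Rdiv_ge0.
(* The true factor of one player and the scaled guess of the other are joined into one function on a
   sum type, so that both are cut along the same levels and [layer_min] applies. *)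
pose h1 (v : (T * X) + (T * Y)) :=
  match v with inl u => uA u.1 u.2 | inr u => vA u.1 u.2 end.
pose h2 (v : (T * X) + (T * Y)) :=
  match v with inl u => vB u.1 u.2 | inr u => uB u.1 u.2 end.
have [n [w [th [w0 hw]]]] : exists n (w th : 'I_n -> R), (forall i, 0 <= w i) /\
    forall v, \sum_(i | Rleb (th i) (h1 v)) w i = h1 v.
  by apply: layer_cake; case=> -[].
have [m [w' [th' [w'0 hw']]]] : exists n (w th : 'I_n -> R), (forall i, 0 <= w i) /\
    forall v, \sum_(i | Rleb (th i) (h2 v)) w i = h2 v.
  by apply: layer_cake; case=> -[].
have huA o x := hw (inl (o, x)); have hvA o y := hw (inr (o, y)).
have hvB o x := hw' (inl (o, x)); have huB o y := hw' (inr (o, y)).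
rewrite /= in huA hvA hvB huB.
pose q (u : T * 'I_n * 'I_m) := if lab u.1.1 then p * (w u.1.2 * w' u.2) else 0.
pose a (u : T * 'I_n * 'I_m) x := Rleb (th u.1.2) (uA u.1.1 x) && Rleb (th' u.2) (vB u.1.1 x).
pose b (u : T * 'I_n * 'I_m) y := Rleb (th u.1.2) (vA u.1.1 y) && Rleb (th' u.2) (uB u.1.1 y).
have q0 u : 0 <= q u.
  by rewrite /q; case: ifP => _; [do ?apply: Rmult_le_pos | lra].
have aL x : \sum_(i | a i x) q i <= p * L.
  rewrite (Rsum_triple lab p w w' (fun o i => Rleb (th i) (uA o x)) (fun o j => Rleb (th' j) (vB o x))).
  rewrite Rsum_mull; apply: Rmult_le_compat_l => //.
  apply: Rle_trans (_ : _ <= \sum_(o | lab o) L * QB x o) _.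
    apply: Rsum_le => o _; rewrite huA hvB /vB.
    have -> : uA o x * (L * (QB x o / uA o x)) = L * (uA o x * (QB x o / uA o x)) by lra.
    by apply: Rmult_le_compat_l => //; exact: Rmult_div_le.
  rewrite Rsum_mull -[X in _ <= X]Rmult_1_r; apply: Rmult_le_compat_l => //.
  by apply: Rle_trans (QB1 x); apply: Rsum_subpred.
have bL y : \sum_(i | b i y) q i <= p * L.
  rewrite (Rsum_triple lab p w w' (fun o i => Rleb (th i) (vA o y)) (fun o j => Rleb (th' j) (uB o y))).
  rewrite Rsum_mull; apply: Rmult_le_compat_l => //.
  apply: Rle_trans (_ : _ <= \sum_(o | lab o) L * QA y o) _.
    apply: Rsum_le => o _; rewrite hvA huB /vA.
    have -> : L * (QA y o / uB o y) * uB o y = L * (uB o y * (QA y o / uB o y)) by lra.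
    by apply: Rmult_le_compat_l => //; exact: Rmult_div_le.
  rewrite Rsum_mull -[X in _ <= X]Rmult_1_r; apply: Rmult_le_compat_l => //.
  by apply: Rle_trans (QA1 y); apply: Rsum_subpred.
have KE u : \sum_(i | a i u.1 && b i u.2) q i =
    p * \sum_(o | lab o) Rmin (uA o u.1) (vA o u.2) * Rmin (vB o u.1) (uB o u.2).
  rewrite -Rsum_mull.
  rewrite (eq_bigr (fun o => p * ((\sum_(i | Rleb (th i) (uA o u.1) && Rleb (th i) (vA o u.2)) w i) *
     (\sum_(j | Rleb (th' j) (vB o u.1) && Rleb (th' j) (uB o u.2)) w' j)))); last first.
    by move=> o _; rewrite !layer_min.
  rewrite -(Rsum_triple lab p w w' (fun o i => Rleb (th i) (uA o u.1) && Rleb (th i) (vA o u.2))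
      (fun o j => Rleb (th' j) (vB o u.1) && Rleb (th' j) (uB o u.2))).
  by apply: eq_bigl => i; rewrite /a /b /= andbACA.
have min0 s r : 0 <= s -> 0 <= r -> 0 <= Rmin s r by move=> *; apply: Rmin_glb.
have pL0 : 0 <= p * L by exact: Rmult_le_pos.
have /= main := random_rectangle q0 mu0 mu1 e00 pL0 aL bL rect.
have hi : \sum_(u | E u) mu u * \sum_(i | a i u.1 && b i u.2) q i <=
    p * (\sum_(u | E u) mu u * \sum_(o | lab o) dens u o).
  rewrite -Rsum_mull; apply: Rsum_le => u _; rewrite KE.
  have -> : p * (mu u * \sum_(o | lab o) dens u o) = mu u * (p * \sum_(o | lab o) dens u o) by lra.
  do 2![apply: Rmult_le_compat_l => //]; apply: Rsum_le => o _.
  by apply: Rmult_le_compat; [exact: min0 | exact: min0 | exact: Rmin_l | exact: Rmin_r].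
have lo : p * (\sum_u mu u * \sum_(o | lab o && good u o) dens u o) <=
    \sum_u mu u * \sum_(i | a i u.1 && b i u.2) q i.
  rewrite -Rsum_mull; apply: Rsum_le => u _; rewrite KE.
  rewrite -Rmult_assoc (Rmult_comm p) Rmult_assoc.
  do 2![apply: Rmult_le_compat_l => //]; rewrite big_mkcondr; apply: Rsum_le => o _.
  case: ifP => [|_]; last by apply: Rmult_le_pos; exact: min0.
  move=> /andP[/RlebP gA /RlebP gB].
  case: (Rle_lt_or_eq_dec _ _ (uA0 o u.1)) => [a0|e]; last first.
    have -> : dens u o = 0 by rewrite /dens -e; lra.
    by apply: Rmult_le_pos; exact: min0.
  case: (Rle_lt_or_eq_dec _ _ (uB0 o u.2)) => [b0|e]; last first.
    have -> : dens u o = 0 by rewrite /dens -e; lra.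
    by apply: Rmult_le_pos; exact: min0.
  (* On a good transcript each scaled guess dominates the true factor, so both minima in [KE] are
     the true factors. *)
  have eA : vA o u.2 * uB o u.2 = L * QA u.2 o by rewrite /vA; field; lra.
  have eB : vB o u.1 * uA o u.1 = L * QB u.1 o by rewrite /vB; field; lra.
  rewrite /dens in gA gB.
  have lA : uA o u.1 <= vA o u.2 by apply: (Rmult_le_reg_r (uB o u.2)) => //; rewrite eA.
  have lB : uB o u.2 <= vB o u.1 by apply: (Rmult_le_reg_r (uA o u.1)) => //; rewrite eB; lra.
  by rewrite (Rmin_left _ _ lA) (Rmin_right _ _ lB); exact: Rle_refl.
apply: Rle_trans (Rle_trans _ _ _ _ main) _; last exact: Rplus_le_compat_r.
apply: Rmult_le_compat_l => //; apply: Rplus_le_compat_r.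
by apply: Rmult_le_compat_l => //; lra.
Qed.

Section CondMarg.
Variables (W : finType) (P : W -> R).
Hypothesis P0 : forall w, 0 <= P w.

Definition cmarg (A B : finType) (phi : W -> A) (psi : W -> B) (a : A) (b : B) : R :=
  marg P (fun w => (phi w, psi w)) (a, b) / marg P phi a.

Lemma cmarg_ge0 (A B : finType) (phi : W -> A) (psi : W -> B) a b : 0 <= cmarg phi psi a b.
Proof. by apply: Rdiv_ge0; exact: marg_ge0. Qed.

Lemma cmarg_gt0 (A B : finType) (phi : W -> A) (psi : W -> B) w :
  0 < P w -> 0 < cmarg phi psi (phi w) (psi w).
Proof.
move=> Pw; apply: Rdiv_lt_0_compat; last exact: marg_gt0.
exact: (marg_gt0 P0 (fun w => (phi w, psi w)) Pw).
Qed.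

(** The conditional law sums to 1 except at a value [a] of mass zero, where it sums to 0. *)
Lemma sum_cmarg (A B : finType) (phi : W -> A) (psi : W -> B) a :
  \sum_b cmarg phi psi a b <= 1.
Proof.
have -> : \sum_b cmarg phi psi a b = marg P phi a / marg P phi a.
  rewrite /cmarg /Rdiv Rsum_mulr; congr (_ * _).
  rewrite (marg_comp P (fun w => (phi w, psi w)) (@fst A B)).
  rewrite (eq_bigl (fun u => (u.1 == a) && (u.2 \in B))) => [|u]; last by rewrite andbT.
  by rewrite -(pair_big (fun i => i == a) xpredT
       (fun i j => marg P (fun w => (phi w, psi w)) (i, j))) /= big_pred1_eq.
case: (Req_dec (marg P phi a) 0) => [->|n0]; first by rewrite /Rdiv Rmult_0_l; lra.
by right; field.
Qed.
End CondMarg.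

(** * From small divergences to a bound for one coordinate *)

Section SingleCopy.
Variables (X Y T W : finType) (P : W -> R) (mu : X * Y -> R).
Variables (cx : W -> X) (cy : W -> Y) (ob : W -> T).
Variables (uA : T -> X -> R) (uB : T -> Y -> R).
Hypothesis P0 : forall w, 0 <= P w.
Hypothesis P1 : \sum_w P w = 1.
Hypothesis mu0 : forall u, 0 <= mu u.
Hypothesis mu1 : \sum_u mu u = 1.
Hypothesis uA0 : forall o x, 0 <= uA o x.
Hypothesis uB0 : forall o y, 0 <= uB o y.

Definition joint (u : X * Y * T) : R := marg P (fun w => (cx w, cy w, ob w)) u.
(** The divergence from the law where the transcript is drawn knowing only Bob's input; it measures
    how well Bob guesses Alice's factor. [klB] is the mirror image. *)
Definition klA : R := kl joint (fun u => mu u.1 * cmarg P cy ob u.1.2 u.2).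
Definition klB : R := kl joint (fun u => mu u.1 * cmarg P cx ob u.1.1 u.2).

Hypothesis factor : forall x y o, joint (x, y, o) = mu (x, y) * (uA o x * uB o y).

Lemma joint_ge0 u : 0 <= joint u. Proof. exact: marg_ge0. Qed.

(** On the bad event the law [joint] exceeds [exp lam * q], so the error term of [kl_event] is at
    most the mass of the event itself; this turns [lam] into [lam - 1]. *)
Lemma bad_prob (q : X * Y * T -> R) (lam : R) :
  (forall u, 0 <= q u) -> (forall w, 0 < P w -> 0 < q (cx w, cy w, ob w)) ->
  \sum_u q u <= 1 ->
  \sum_(u | ~~ Rleb (uA u.2 u.1.1 * uB u.2 u.1.2 * mu u.1) (exp lam * q u)) joint u * (lam - 1) <=
  kl joint q.
Proof.
move=> q0 ac q1.
pose E (u : X * Y * T) := ~~ Rleb (uA u.2 u.1.1 * uB u.2 u.1.2 * mu u.1) (exp lam * q u).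
have h : forall u, 0 < joint u -> 0 < q u by move=> u /(gt0_of_marg P0)[w <-]; exact: ac.
have j1 : \sum_u joint u = 1 by rewrite marg_sum.
have := kl_event E lam joint_ge0 q0 h j1 q1.
have : exp lam * \sum_(u | E u) q u <= \sum_(u | E u) joint u.
  rewrite -Rsum_mull; apply: Rsum_le => -[[x y] o]; rewrite /E => /RlebP /=.
  by rewrite factor; lra.
have : 0 <= \sum_(u | E u) q u by exact: Rsum_ge0.
move=> h1 h2 h3; rewrite Rsum_mulr -[X in X * _ <= _]/(\sum_(u | E u) joint u); lra.
Qed.

(** [zero_communication] with the scale [L = exp lam] and conditional laws as guesses. By
    [bad_prob], the transcripts that are not good cost at most [(klA + klB) / (lam - 1)]. *)
Lemma single_copy (lab : pred T) (E : pred (X * Y)) (e0 sig lam p : R) :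
  0 <= e0 -> 1 < lam -> 0 <= p -> p * exp lam <= 1 ->
  (forall AB, e0 * (prob mu (in_rect AB) - sig) <=
              prob mu (fun u => in_rect AB u && E u)) ->
  e0 * ((1 - p * exp lam) * (p * (\sum_(w | lab (ob w)) P w - (klA + klB) / (lam - 1))) - sig) <=
  p * \sum_(w | E (cx w, cy w) && lab (ob w)) P w + (p * exp lam) * (p * exp lam).
Proof.
move=> e00 lam1 p0 pL rect.
have main := zero_communication lab mu0 mu1 uA0 uB0 (cmarg_ge0 P0 cy ob) (cmarg_ge0 P0 cx ob)
  (sum_cmarg P cy ob) (sum_cmarg P cx ob) e00 (Rlt_le _ _ (exp_pos lam)) p0 pL rect.
cbv zeta in main.
have conv (D : pred (X * Y)) (G : X * Y -> T -> bool) :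
    \sum_(u | D u) mu u * \sum_(o | G u o) (uA o u.1 * uB o u.2) =
    \sum_(u | D u.1 && G u.1 u.2) joint u.
  rewrite -(pair_big_dep D G (fun i j => joint (i, j))) /=.
  by apply: eq_bigr => -[x y] _; rewrite -Rsum_mull; apply: eq_bigr => o _; rewrite factor.
rewrite !conv in main.
have e1 : \sum_(u | E u.1 && lab u.2) joint u = \sum_(w | E (cx w, cy w) && lab (ob w)) P w.
  exact: (sum_marg_pred P (fun w => (cx w, cy w, ob w)) (fun u => E u.1 && lab u.2)).
rewrite e1 in main; apply: Rle_trans main; apply: Rmult_le_compat_l => //.
apply: Rplus_le_compat_r; apply: Rmult_le_compat_l; first lra.
apply: Rmult_le_compat_l => //.
rewrite -(sum_marg_pred P (fun w => (cx w, cy w, ob w)) (fun u => lab u.2)).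
have qs (A : finType) (phi : W -> A) (h : X * Y -> A) :
    \sum_(u : X * Y * T) mu u.1 * cmarg P phi ob (h u.1) u.2 <= 1.
  rewrite -(pair_big xpredT xpredT (fun i j => mu i * cmarg P phi ob (h i) j)) /= -mu1.
  apply: Rsum_le => u _; rewrite Rsum_mull -[X in _ <= X]Rmult_1_r.
  by apply: Rmult_le_compat_l => //; exact: sum_cmarg.
have mup w : 0 < P w -> 0 < mu (cx w, cy w).
  move=> Pw; have := marg_gt0 P0 (fun w => (cx w, cy w, ob w)) Pw.
  rewrite -/(joint _) factor => h; have := mu0 (cx w, cy w); case=> // e.
  by move: h; rewrite -e; lra.
have ba := @bad_prob (fun u => mu u.1 * cmarg P cy ob u.1.2 u.2) lam.
have bb := @bad_prob (fun u => mu u.1 * cmarg P cx ob u.1.1 u.2) lam.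
have {}ba := ba (fun u => Rmult_le_pos _ _ (mu0 _) (cmarg_ge0 P0 cy ob _ _))
  (fun w h => Rmult_lt_0_compat _ _ (mup w h) (cmarg_gt0 P0 cy ob h)) (qs _ cy snd).
have {}bb := bb (fun u => Rmult_le_pos _ _ (mu0 _) (cmarg_ge0 P0 cx ob _ _))
  (fun w h => Rmult_lt_0_compat _ _ (mup w h) (cmarg_gt0 P0 cx ob h)) (qs _ cx fst).
rewrite Rsum_mulr -/klA in ba; rewrite Rsum_mulr -/klB in bb.
set SA := \big[Rplus/0]_(u | _) _ in ba; set SB := \big[Rplus/0]_(u | _) _ in bb.
have : SA + SB <= (klA + klB) / (lam - 1).
  apply: (Rmult_le_reg_r (lam - 1)); first lra.
  have -> : (klA + klB) / (lam - 1) * (lam - 1) = klA + klB by field; lra.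
  lra.
move=> bad; have tr s1 s2 s3 : s1 <= SA + SB + s2 -> SA + SB <= s3 -> s1 - s3 <= s2 by lra.
apply: tr bad.
rewrite /SA /SB big_mkcond [X in _ <= X + _ + _]big_mkcond [X in _ <= _ + X + _]big_mkcond.
rewrite [X in _ <= _ + X]big_mkcond -!big_split; apply: Rsum_le => u _ /=.
have j0 := joint_ge0 u; case: ifP => _ /=; last by do 2!case: ifP => _; lra.
rewrite -[X in X <= _]/(joint u).
(* The events of [bad_prob] carry an extra factor [mu u.1]; it cancels when positive, and otherwise
   [joint u] vanishes. *)
case: (Rle_lt_or_eq_dec _ _ (mu0 u.1)) => [m0|m0]; last first.
  have -> : joint u = 0 by case: u m0 {j0} => -[x y] o /= m0; rewrite factor -m0; lra.
  by do 3!case: ifP => _; lra.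
have red c : Rleb (uA u.2 u.1.1 * uB u.2 u.1.2 * mu u.1) (exp lam * (mu u.1 * c)) =
             Rleb (uA u.2 u.1.1 * uB u.2 u.1.2) (exp lam * c).
  by apply/RlebP/RlebP => h; [apply: (Rmult_le_reg_r (mu u.1)) | ]; nra.
by rewrite !red; case: Rleb; case: Rleb => /=; lra.
Qed.
End SingleCopy.

(** * The chain rule *)

(** The restriction of [v] to [S], padded by a default value so that restrictions to all sets [S]
    share one type. *)
Definition keep_on (t : nat) (V : finType) (v0 : V) (S : {set 'I_t}) (v : {ffun 'I_t -> V}) :
  {ffun 'I_t -> V} := [ffun i => if i \in S then v i else v0].

Lemma keep_on_eqE (t : nat) (V : finType) (v0 : V) (S : {set 'I_t}) (v v' : {ffun 'I_t -> V}) :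
  (keep_on v0 S v == keep_on v0 S v') = [forall (i | i \in S), v i == v' i].
Proof.
apply/eqP/forall_inP => [h i iS|h].
  by move/ffunP/(_ i): h; rewrite !ffunE iS => ->.
by apply/ffunP => i; rewrite !ffunE; case: ifP => // /h /eqP.
Qed.

Section Chain.
Variables (W X Y M T : finType) (t : nat) (P : W -> R) (mu : X -> Y -> R) (y0 : Y).
Variables (xi : W -> {ffun 'I_t -> X}) (up : W -> {ffun 'I_t -> Y}) (mm : W -> M).
Variables (C : {set 'I_t}) (A B : 'I_t -> {set 'I_t}) (ob : 'I_t -> W -> T) (l : R).
Hypothesis P0 : forall w, 0 <= P w.
Hypothesis P1 : \sum_w P w = 1.
Hypothesis mu0 : forall x y, 0 <= mu x y.
Hypothesis mu1 : \sum_x \sum_y mu x y = 1.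
Hypothesis mup : forall w, 0 < P w -> forall i, 0 < mu (xi w i) (up w i).
Hypothesis obE : forall j w w', (ob j w == ob j w') =
  [&& [forall (i | i \in A j), xi w i == xi w' i],
      [forall (i | i \in B j), up w i == up w' i] & mm w == mm w'].
Hypothesis tele : forall G : {set 'I_t} -> R,
  \sum_(j | j \notin C) (G (j |: B j) - G (B j)) = G setT - G C.
Hypothesis full : Elog P (fun w => (xi w, up w, mm w)) <=
  l + \sum_w P w * \sum_i ln (mu (xi w i) (up w i)).

Let G (S : {set 'I_t}) : R := Elog P (fun w => (xi w, keep_on y0 S (up w), mm w)).

(** Submodularity: revealing all of [xi], on top of [xi w j] and [ob j], can only lower the
    conditional entropy of coordinate [j] of [up]. *)
Lemma chain_step j :
  Elog P (fun w => (xi w j, up w j, ob j w)) - Elog P (fun w => (xi w j, ob j w)) <=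
  G (j |: B j) - G (B j).
Proof.
have := Elog_submodular P0 P1 (fun w => (xi w j, ob j w)) (fun w => up w j) xi.
have -> : Elog P (fun w => (xi w j, ob j w, up w j)) = Elog P (fun w => (xi w j, up w j, ob j w)).
  by apply: Elog_key => v v'; rewrite !xpair_eqE andbAC.
have -> : Elog P (fun w => (xi w j, ob j w, xi w)) = G (B j).
  apply: Elog_key => v v'; rewrite !xpair_eqE keep_on_eqE obE.
  apply/idP/idP => [/andP[/andP[_ /and3P[_ -> ->]] ->] //|/andP[/andP[/eqP-> ->] ->]].
  by rewrite !eqxx !andbT; apply/forall_inP.
have -> : Elog P (fun w => (xi w j, ob j w, up w j, xi w)) = G (j |: B j).
  apply: Elog_key => v v'; rewrite !xpair_eqE keep_on_eqE obE.
  apply/idP/idP => [/andP[/andP[/andP[_ /and3P[_ /forall_inP h ->]] u] ->]|].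
    by rewrite andbT; apply/forall_inP => i; rewrite in_setU1 => /orP[/eqP->|/h].
  move=> /andP[/andP[/eqP-> /forall_inP h] ->]; rewrite !eqxx !andbT /=.
  rewrite h ?setU11 // andbT; apply/andP; split; apply/forall_inP => // i iB.
  by apply: h; rewrite in_setU1 iB orbT.
lra.
Qed.

Let px (i : 'I_t) (x : X) : R := marg P (fun w => xi w i) x.

(** Gibbs' inequality with a product model: [mu] on the coordinates of [C], the true marginals of
    [xi] on the others, and a uniform leaf, which costs [ln (INR #|M|)]. *)
Lemma chain_base : \sum_(j | j \in C) \sum_w P w * ln (mu (xi w j) (up w j)) +
  \sum_(j | j \notin C) Elog P (fun w => xi w j) - ln (INR #|M|) <= G C.
Proof.
(* Outside [C] the second vector has been padded with [y0], so the model puts all its mass there. *)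
pose F (i : 'I_t) (x : X) (y : Y) : R :=
  if i \in C then mu x y else if y == y0 then px i x else 0.
have px0 i x : 0 <= px i x by exact: marg_ge0.
have M0 : 0 < INR #|M|.
  have : exists w : W, True.
    case: (pickP (@predT W)) => [w _|no]; first by exists w.
    by move: P1; rewrite big_pred0 => [|w]; [lra | have := no w].
  case=> w _; apply: lt_0_INR; apply/ltP; apply/card_gt0P; by exists (mm w).
have F0 i x y : 0 <= F i x y by rewrite /F; do 2?case: ifP => _ //; lra.
pose q (u : {ffun 'I_t -> X} * {ffun 'I_t -> Y} * M) :=
  (\prod_i F i (u.1.1 i) (u.1.2 i)) * / INR #|M|.
have Mi : 0 < / INR #|M| by exact: Rinv_0_lt_compat.
have q0 u : 0 <= q u by apply: Rmult_le_pos; [exact: Rprod_ge0 | lra].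
have q1 : \sum_u q u <= 1.
  right; rewrite -(pair_big xpredT xpredT (fun u m => q (u, m))) /=.
  under eq_bigr => u _ do rewrite /q /= Rsum_const.
  rewrite -(pair_big xpredT xpredT (fun (x : {ffun 'I_t -> X}) (y : {ffun 'I_t -> Y}) =>
     INR #|M| * (\prod_i F i (x i) (y i) * / INR #|M|))) /=.
  have ffX := @Rsum_ffun_prod 'I_t X (fun i x => \sum_y F i x y).
  have ffY x := @Rsum_ffun_prod 'I_t Y (fun i y => F i (x i) y).
  rewrite /= in ffX ffY.
  transitivity (\sum_(x : {ffun 'I_t -> X}) \prod_(i : 'I_t) \sum_y F i (x i) y).
    apply: eq_bigr => x _; rewrite -ffY.
    apply: eq_bigr => y _; rewrite Rmult_comm Rmult_assoc Rinv_l; last exact: Rgt_not_eq.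
    exact: Rmult_1_r.
  rewrite ffX big1 // => i _; rewrite /F.
  case: (i \in C); first exact: mu1.
  under eq_bigr => x _ do rewrite -big_mkcond big_pred1_eq.
  by rewrite marg_sum.
have Fp w i : 0 < P w -> 0 < F i (xi w i) (keep_on y0 C (up w) i).
  move=> Pw; rewrite /F ffunE; case: (i \in C); first exact: mup.
  by rewrite eqxx; exact: (marg_gt0 P0 (fun w => xi w i) Pw).
have qp w : 0 < P w -> 0 < q (xi w, keep_on y0 C (up w), mm w).
  by move=> Pw; apply: Rmult_lt_0_compat => //; apply: Rprod_gt0 => i _; exact: Fp.
have := gibbs P0 P1 q0 q1 qp; rewrite -/(G C) => gib; apply: Rle_trans gib.
right.
transitivity (\sum_w P w * (\sum_(j | j \in C) ln (mu (xi w j) (up w j)) +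
   \sum_(j | j \notin C) ln (px j (xi w j)) - ln (INR #|M|))).
  under [RHS]eq_bigr => w _ do rewrite Rmult_minus_distr_l Rmult_plus_distr_l -!Rsum_mull.
  rewrite Rsum_sub big_split /= Rsum_mulr P1 Rmult_1_l; congr (_ + _ - _).
    by rewrite exchange_big.
  by rewrite exchange_big.
apply: eq_bigr => w _; case: (Rle_lt_or_eq_dec _ _ (P0 w)) => [Pw|<-]; last lra.
rewrite /q /= ln_mult //; last by apply: Rprod_gt0 => i _; exact: Fp.
rewrite ln_Rinv // ln_prod; last by move=> i _; exact: Fp.
rewrite [X in _ = _ * (X + _)](bigID (fun j => j \in C)) /= /Rminus; congr (_ * (_ + _ + _)).
  by apply: eq_bigr => i iC; rewrite /F ffunE iC.
by apply: eq_bigr => i /negbTE iC; rewrite /F ffunE iC eqxx.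
Qed.

(** The increments of [chain_step] telescope to [G setT - G C]; [full] bounds the first term above,
    [chain_base] the second below, and all terms but [l + ln (INR #|M|)] cancel. *)
Lemma chain_bound : \sum_(j | j \notin C)
  (Elog P (fun w => (xi w j, up w j, ob j w)) - Elog P (fun w => (xi w j, ob j w)) +
   Elog P (fun w => xi w j) - \sum_w P w * ln (mu (xi w j) (up w j))) <= l + ln (INR #|M|).
Proof.
apply: Rle_trans (_ : _ <= \sum_(j | j \notin C) (G (j |: B j) - G (B j)) +
   (\sum_(j | j \notin C) Elog P (fun w => xi w j) -
    \sum_(j | j \notin C) \sum_w P w * ln (mu (xi w j) (up w j)))) _.
  rewrite -Rsum_sub -big_split; apply: Rsum_le => j _ /=; have tr a b c d e : a - b <= c -> a - b + d - e <= c + (d - e) by lra.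
  exact/tr/chain_step.
rewrite tele; have cb := chain_base.
have GT : G setT = Elog P (fun w => (xi w, up w, mm w)).
  apply: Elog_key => v v'; rewrite !xpair_eqE keep_on_eqE; congr (_ && _ && _).
  apply/forall_inP/eqP => [h|-> //]; apply/ffunP => i; exact/eqP/h.
have e : \sum_w P w * \sum_i ln (mu (xi w i) (up w i)) =
   \sum_(j | j \in C) \sum_w P w * ln (mu (xi w j) (up w j)) +
   \sum_(j | j \notin C) \sum_w P w * ln (mu (xi w j) (up w j)).
  under eq_bigr => w _ do rewrite -Rsum_mull.
  by rewrite exchange_big (bigID (fun j => j \in C)).
move: full; rewrite e -GT; lra.
Qed.
End Chain.

(** * Conditioning on success *)

(** Each bit constrains only its speaker's input, so by induction on the tree the inputs reaching a
    leaf form a rectangle. *)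
Lemma proto_leaves (A B O : Type) (P : proto A B O) :
  exists (M : finType) (lf : A -> B -> M) (pA : M -> A -> bool) (pB : M -> B -> bool)
         (out : M -> O),
  [/\ (#|M| <= 2 ^ depth P)%N,
      forall a b m, (lf a b == m) = pA m a && pB m b &
      forall a b, run P a b = out (lf a b)].
Proof.
elim: P => [o|g l [Ml [fl [al [bl [ol [cl rl hl]]]]]] r [Mr [fr [ar [br [or [cr rr hr]]]]]]
             |g l [Ml [fl [al [bl [ol [cl rl hl]]]]]] r [Mr [fr [ar [br [or [cr rr hr]]]]]]].
- exists unit, (fun _ _ => tt), (fun _ _ => true), (fun _ _ => true), (fun _ => o).
  by split=> [|a b []|]; rewrite ?card_unit.
- exists (Ml + Mr)%type, (fun a b => if g a then inl (fl a b) else inr (fr a b)),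
    (fun m a => match m with inl m => g a && al m a | inr m => ~~ g a && ar m a end),
    (fun m b => match m with inl m => bl m b | inr m => br m b end),
    (fun m => match m with inl m => ol m | inr m => or m end).
  split=> /=.
  + rewrite card_sum expnS mul2n -addnn; apply: leq_add.
      by apply: leq_trans cl _; rewrite leq_exp2l // leq_maxl.
    by apply: leq_trans cr _; rewrite leq_exp2l // leq_maxr.
  + by move=> a b [m|m]; case: (g a) => //=; [rewrite -rl | rewrite -rr].
  + by move=> a b; case: (g a).
- exists (Ml + Mr)%type, (fun a b => if g b then inl (fl a b) else inr (fr a b)),
    (fun m a => match m with inl m => al m a | inr m => ar m a end),
    (fun m b => match m with inl m => g b && bl m b | inr m => ~~ g b && br m b end),
    (fun m => match m with inl m => ol m | inr m => or m end).
  split=> /=.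
  + rewrite card_sum expnS mul2n -addnn; apply: leq_add.
      by apply: leq_trans cl _; rewrite leq_exp2l // leq_maxl.
    by apply: leq_trans cr _; rewrite leq_exp2l // leq_maxr.
  + by move=> a b [m|m]; case: (g b) => //=; rewrite ?andbF // -?rl -?rr.
  + by move=> a b; case: (g b).
Qed.

Lemma telescope (n : nat) (H : nat -> R) : \sum_(i < n) (H i.+1 - H i) = H n - H 0%N.
Proof.
elim: n => [|n IH]; first by rewrite big_ord0; lra.
by rewrite big_ord_recr /= IH; lra.
Qed.

(** * Revealing the coordinates in increasing or decreasing order *)

Section Orders.
Variables (t : nat) (C : {set 'I_t}).

Definition lower (j : 'I_t) : {set 'I_t} := [set i : 'I_t | (i < j)%N || (i \in C)].
Definition upper (j : 'I_t) : {set 'I_t} := [set i : 'I_t | (j < i)%N || (i \in C)].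

Lemma telescope_lower (G : {set 'I_t} -> R) :
  \sum_(j | j \notin C) (G (j |: lower j) - G (lower j)) = G setT - G C.
Proof.
pose H n := G [set i : 'I_t | (i < n)%N || (i \in C)].
have -> : G setT = H t.
  by congr G; apply/setP => i; rewrite !inE ltn_ord.
have -> : G C = H 0%N by congr G; apply/setP => i; rewrite !inE.
have eS (j : 'I_t) : G (j |: lower j) = H j.+1.
  by congr G; apply/setP => i; rewrite !inE ltnS [in RHS]leq_eqVlt -val_eqE orbA.
rewrite -(telescope t H) big_mkcond /=; apply: eq_bigr => j _; rewrite eS.
case: ifP => // /negbFE jC; rewrite -eS /H.
have -> : j |: lower j = lower j by apply/setUidPr; rewrite sub1set !inE jC orbT.
by rewrite /lower; lra.
Qed.

Lemma telescope_upper (G : {set 'I_t} -> R) :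
  \sum_(j | j \notin C) (G (j |: upper j) - G (upper j)) = G setT - G C.
Proof.
(* Here the coordinates are revealed from the last to the first; the sign restores the direction of
   [telescope]. *)
pose H n := - G [set i : 'I_t | (n <= i)%N || (i \in C)].
have -> : G C = - H t.
  rewrite /H Ropp_involutive; congr G; apply/setP => i; rewrite !inE.
  by rewrite leqNgt ltn_ord.
have -> : G setT = - H 0%N by rewrite /H Ropp_involutive; congr G; apply/setP => i; rewrite !inE.
have eS (j : 'I_t) : G (j |: upper j) = - H j.
  rewrite /H Ropp_involutive; congr G; apply/setP => i; rewrite !inE [in RHS]leq_eqVlt.
  by rewrite -val_eqE [in LHS]eq_sym orbA.
have -> : - H 0%N - - H t = H t - H 0%N by lra.
rewrite -(telescope t H) big_mkcond /=; apply: eq_bigr => j _; rewrite eS.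
have eU : G (upper j) = - H j.+1 by rewrite /H Ropp_involutive.
case: ifP => [_|/negbFE jC]; first by rewrite eU; lra.
have : j |: upper j = upper j by apply/setUidPr; rewrite sub1set !inE jC orbT.
by move=> e; have := eS j; rewrite e eU; lra.
Qed.

(** In the first product the coordinates of [y] are observed, in the second those of [x]; each
    product thus depends on one player's hidden input only. *)
Lemma prod_split (F : 'I_t -> R) (j : 'I_t) : j \notin C ->
  \prod_(i : 'I_t) F i = F j * (\prod_(i | (i \notin C) && (j < i)%N) F i *
                                \prod_(i | i \in lower j) F i).
Proof.
move=> jC; rewrite (bigD1 j) //= (bigID (fun i => i \in lower j)) /=; congr (_ * _).
rewrite Rmult_comm; congr (_ * _); apply: eq_bigl => i; rewrite !inE.
  by rewrite negb_or -leqNgt [(j < i)%N]ltn_neqAle -val_eqE eq_sym; case: (i \in C); rewrite ?andbF ?andbT.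
case: (i =P j) => [->|] /=; first by rewrite ltnn (negbTE jC).
by [].
Qed.
End Orders.

Section Klformula.
Variables (X Y T W : finType) (P : W -> R) (mu : X * Y -> R).
Variables (cx : W -> X) (cy : W -> Y) (ob : W -> T).
Hypothesis P0 : forall w, 0 <= P w.
Hypothesis mup : forall w, 0 < P w -> 0 < mu (cx w, cy w).

(** Brings the divergences to the shape of the summands in [chain_bound]. *)
Let kl_formula (A : finType) (phi : W -> A) (h : X * Y -> A) :
  (forall w, h (cx w, cy w) = phi w) ->
  kl (joint P cx cy ob) (fun u => mu u.1 * cmarg P phi ob (h u.1) u.2) =
  Elog P (fun w => (cx w, cy w, ob w)) - Elog P (fun w => (phi w, ob w)) + Elog P phi -
  \sum_w P w * ln (mu (cx w, cy w)).
Proof.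
move=> hE; rewrite kl_margE // => [|w Pw]; last first.
  by rewrite /= hE; apply: Rmult_lt_0_compat; [exact: mup | exact: cmarg_gt0].
have tr a b c d e : e = d + b - c -> a - e = a - b + c - d by lra.
apply: tr; rewrite /Elog -big_split -Rsum_sub /=; apply: eq_bigr => w _.
case: (Rle_lt_or_eq_dec _ _ (P0 w)) => [Pw|<-]; last lra.
have m1 := marg_gt0 P0 phi Pw; have m2 := marg_gt0 P0 (fun w => (phi w, ob w)) Pw.
rewrite hE ln_mult; [|exact: mup|exact: cmarg_gt0].
by rewrite /cmarg ln_div //; lra.
Qed.

Lemma klB_E : klB P mu cx cy ob = Elog P (fun w => (cx w, cy w, ob w)) -
  Elog P (fun w => (cx w, ob w)) + Elog P cx - \sum_w P w * ln (mu (cx w, cy w)).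
Proof. exact: (kl_formula (h := fst)). Qed.

Lemma klA_E : klA P mu cx cy ob = Elog P (fun w => (cy w, cx w, ob w)) -
  Elog P (fun w => (cy w, ob w)) + Elog P cy - \sum_w P w * ln (mu (cx w, cy w)).
Proof.
rewrite /klA (kl_formula (phi := cy) (h := snd)) //.
have -> // : Elog P (fun w => (cx w, cy w, ob w)) = Elog P (fun w => (cy w, cx w, ob w)).
by apply: Elog_key => v v'; rewrite !xpair_eqE; congr (_ && _); rewrite andbC.
Qed.
End Klformula.

(** * The law of the instances given success on [C] *)

Section Conditioning.
Variables (X Y Z M : finType) (f : relation3 X Y Z) (t : nat) (mu : X * Y -> R).
Variables (x0 : X) (y0 : Y).
Local Notation XT := {ffun 'I_t -> X}.
Local Notation YT := {ffun 'I_t -> Y}.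
Variables (lf : XT -> YT -> M) (pA : M -> XT -> bool) (pB : M -> YT -> bool).
Variables (out : M -> {ffun 'I_t -> Z}).
Hypothesis mu0 : forall u, 0 <= mu u.
Hypothesis mu1 : \sum_u mu u = 1.
Hypothesis leafE : forall a b m, (lf a b == m) = pA m a && pB m b.

Definition wgt (w : XT * YT) : R := \prod_i mu (w.1 i, w.2 i).
Definition ok (i : 'I_t) (w : XT * YT) : bool := (w.1 i, w.2 i, out (lf w.1 w.2) i) \in f.
Definition win (C : {set 'I_t}) (w : XT * YT) : bool := [forall (i | i \in C), ok i w].
Definition succ (C : {set 'I_t}) : R := \sum_(w | win C w) wgt w.

Lemma wgt_ge0 w : 0 <= wgt w. Proof. exact: Rprod_ge0. Qed.

Lemma sum_ffun2 (F : 'I_t -> X * Y -> R) : (forall i, \sum_u F i u = 1) ->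
  \sum_(w : XT * YT) \prod_i F i (w.1 i, w.2 i) = 1.
Proof.
move=> h; rewrite -(pair_big xpredT xpredT (fun (a : XT) (b : YT) =>
  \prod_(i : 'I_t) F i (a i, b i))) /=.
have ffX := @Rsum_ffun_prod 'I_t X (fun i x => \sum_y F i (x, y)).
have ffY (a : XT) := @Rsum_ffun_prod 'I_t Y (fun i y => F i (a i, y)).
rewrite /= in ffX ffY.
rewrite (eq_bigr (fun a : XT => \prod_(i : 'I_t) \sum_y F i (a i, y))) => [|a _]; last exact: ffY.
rewrite ffX big1 // => i _; rewrite pair_big -(h i); by apply: eq_bigr => -[].
Qed.

Lemma sum_wgt : \sum_w wgt w = 1.
Proof. exact: (sum_ffun2 (F := fun _ => mu)). Qed.

Section Fixed.
Variable C : {set 'I_t}.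
Hypothesis s0 : 0 < succ C.

Definition post (w : XT * YT) : R := if win C w then wgt w / succ C else 0.

Lemma post_ge0 w : 0 <= post w.
Proof.
rewrite /post; case: ifP => _; last lra.
by apply: Rdiv_ge0; [exact: wgt_ge0 | lra].
Qed.

Lemma post_sum1 : \sum_w post w = 1.
Proof. by rewrite -big_mkcond /= Rsum_mulr -/(succ C); field; lra. Qed.

Lemma post_gt0 w : 0 < post w -> win C w /\ forall i, 0 < mu (w.1 i, w.2 i).
Proof.
rewrite /post; case: ifP => [_ h|]; last lra.
split=> // i; case: (Rle_lt_or_eq_dec _ _ (mu0 (w.1 i, w.2 i))) => // e.
by move: h; rewrite /wgt (bigD1 i) //= -e Rmult_0_l /Rdiv Rmult_0_l; lra.
Qed.

(** The divergence of [post] from the product law [wgt] is [- ln (succ C)], because conditioning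
    rescales the density by a constant. *)
Lemma post_full : \sum_w post w * ln (post w) =
  - ln (succ C) + \sum_w post w * \sum_i ln (mu (w.1 i, w.2 i)).
Proof.
rewrite -[X in X + _]Rmult_1_r -post_sum1 -Rsum_mull -big_split; apply: eq_bigr => w _ /=.
case: (Rle_lt_or_eq_dec _ _ (post_ge0 w)) => [pw|<-]; last lra.
have [win_w mp] := post_gt0 pw.
rewrite [in ln _]/post win_w ln_div //; last by apply: Rprod_gt0.
rewrite /wgt ln_prod //.
have tr a b c : a * (b - c) = - c * a + a * b by lra.
exact: tr.
Qed.

Definition cx (j : 'I_t) (w : XT * YT) : X := w.1 j.
Definition cy (j : 'I_t) (w : XT * YT) : Y := w.2 j.
Definition ob (j : 'I_t) (w : XT * YT) : XT * YT * M :=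
  (keep_on x0 (lower C j) w.1, keep_on y0 (upper C j) w.2, lf w.1 w.2).

Lemma card_leaf_gt0 : 0 < INR #|M|.
Proof.
apply: lt_0_INR; apply/ltP; apply/card_gt0P.
by exists (lf [ffun => x0] [ffun => y0]).
Qed.

(** [chain_bound] with [x] known in full and [y] revealed in decreasing order. *)
Lemma sum_klB : \sum_(j | j \notin C) klB post mu (cx j) (cy j) (ob j) <=
  - ln (succ C) + ln (INR #|M|).
Proof.
have mup j w : 0 < post w -> 0 < mu (cx j w, cy j w) by move=> /post_gt0[_]; apply.
rewrite (eq_bigr _ (fun j _ => klB_E (cx := cx j) (ob j) post_ge0 (mup j))).
apply: (@chain_bound _ _ _ _ _ t post (fun x y => mu (x, y)) y0 fst snd
  (fun w => lf w.1 w.2) C (lower C) (upper C)) => //.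
- exact: post_ge0.
- exact: post_sum1.
- by rewrite -mu1 pair_big; apply: eq_bigr => -[].
- by move=> w /post_gt0[].
- by move=> j w w'; rewrite !xpair_eqE !keep_on_eqE andbA.
- exact: telescope_upper.
right; rewrite -post_full; apply: eq_bigr => w _; congr (_ * ln _).
rewrite /marg (big_pred1 w) // => v; rewrite !xpair_eqE.
by apply/andP/eqP => [[/andP[/eqP e1 /eqP e2] _]|->]; [case: v w e1 e2 => ? ? [? ?] /= -> -> | rewrite !eqxx].
Qed.

(** The same with the players exchanged: [y] is known and [x] is revealed in increasing order. *)
Lemma sum_klA : \sum_(j | j \notin C) klA post mu (cx j) (cy j) (ob j) <=
  - ln (succ C) + ln (INR #|M|).
Proof.
have mup j w : 0 < post w -> 0 < mu (cx j w, cy j w) by move=> /post_gt0[_]; apply.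
rewrite (eq_bigr _ (fun j _ => klA_E (cx := cx j) (ob j) post_ge0 (mup j))).
apply: (@chain_bound _ _ _ _ _ t post (fun y x => mu (x, y)) x0 snd fst
  (fun w => lf w.1 w.2) C (upper C) (lower C)) => //.
- exact: post_ge0.
- exact: post_sum1.
- by rewrite -mu1 exchange_big pair_big; apply: eq_bigr => -[].
- by move=> w /post_gt0[].
- by move=> j w w'; rewrite !xpair_eqE !keep_on_eqE andbA; congr (_ && _); rewrite andbC.
- exact: telescope_lower.
right; rewrite -post_full; apply: eq_bigr => w _; congr (_ * ln _).
rewrite /marg (big_pred1 w) // => v; rewrite !xpair_eqE.
by apply/andP/eqP => [[/andP[/eqP e1 /eqP e2] _]|->]; [case: v w e1 e2 => ? ? [? ?] /= -> -> | rewrite !eqxx].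
Qed.

Definition kl0 (j : 'I_t) : R := kl (marg post (fun w => (cx j w, cy j w))) mu.

Lemma kl0_ge0 j : 0 <= kl0 j.
Proof.
apply: kl_marg_ge0 => //; [exact: post_ge0 | exact: post_sum1 | by rewrite mu1; lra |].
by move=> w /post_gt0[_]; apply.
Qed.

(** Divergence from a product law is superadditive over coordinates: compare [post] with the product
    of its marginals by [gibbs], and compute the total by [post_full]. *)
Lemma sum_kl0 : \sum_(j | j \notin C) kl0 j <= - ln (succ C).
Proof.
apply: Rle_trans (_ : _ <= \sum_j kl0 j) _; first by apply: Rsum_subpred => // j; exact: kl0_ge0.
pose q (w : XT * YT) := \prod_i marg post (fun w => (cx i w, cy i w)) (w.1 i, w.2 i).
have m0 i u := marg_ge0 post_ge0 (fun w => (cx i w, cy i w)) u.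
have mp w i : 0 < post w -> 0 < marg post (fun w => (cx i w, cy i w)) (w.1 i, w.2 i).
  exact: (marg_gt0 post_ge0 (fun w => (cx i w, cy i w))).
have := @gibbs _ post post_ge0 post_sum1 _ id q.
have h1 : forall w, 0 <= q w by move=> w; exact: Rprod_ge0.
have h2 : \sum_w q w <= 1.
  by right; apply: (sum_ffun2 (F := fun i u => marg post (fun w => (cx i w, cy i w)) u)) => i;
     rewrite marg_sum post_sum1.
have h3 w : 0 < post w -> 0 < q w by move=> pw; apply: Rprod_gt0 => i _; exact: mp.
move=> /(_ h1 h2 h3).
have -> : Elog post id = \sum_w post w * ln (post w).
  by apply: eq_bigr => w _; rewrite /marg big_pred1_eq.
rewrite post_full => main.
have e : \sum_j kl0 j = \sum_w post w * ln (q w) - \sum_w post w * \sum_i ln (mu (w.1 i, w.2 i)).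
  rewrite -Rsum_sub.
  under eq_bigr => j _ do rewrite /kl0 kl_marg.
  rewrite exchange_big; apply: eq_bigr => w _ /=; rewrite Rsum_mull.
  case: (Rle_lt_or_eq_dec _ _ (post_ge0 w)) => [pw|<-]; last lra.
  rewrite /q ln_prod => [|i _]; last exact: mp.
  rewrite -Rmult_minus_distr_l -Rsum_sub; congr (_ * _); apply: eq_bigr => i _.
  by apply: ln_div; [exact: mp | case/post_gt0: pw => _; apply].
rewrite e; lra.
Qed.

Section Coordinate.
Variable j : 'I_t.
Hypothesis jC : j \notin C.

Definition fA (o : XT * YT * M) (x : X) : R :=
  \sum_(a : XT | [&& a j == x, keep_on x0 (lower C j) a == o.1.1 & pA o.2 a])
    \prod_(i | (i \notin C) && (j < i)%N) mu (a i, o.1.2 i).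

(** The success condition on [C] and the normalisation are charged to Bob; this is possible because
    the coordinates of [x] in [C] and the leaf can be read from [o]. *)
Definition fB (o : XT * YT * M) (y : Y) : R :=
  (\sum_(b : YT | [&& b j == y, keep_on y0 (upper C j) b == o.1.2, pB o.2 b &
                   [forall (i | i \in C), (o.1.1 i, b i, out o.2 i) \in f]])
    \prod_(i | i \in lower C j) mu (o.1.1 i, b i)) / succ C.

Lemma fA_ge0 o x : 0 <= fA o x.
Proof. by apply: Rsum_ge0 => a _; exact: Rprod_ge0. Qed.

Lemma fB_ge0 o y : 0 <= fB o y.
Proof. by apply: Rdiv_ge0; [apply: Rsum_ge0 => a _; exact: Rprod_ge0 | lra]. Qed.

(* Given the observed coordinates, every unobserved coordinate of [x] faces an observed
   coordinate of [y] and vice versa, so that the remaining randomness is independent. *)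
Lemma post_factor x y o :
  joint post (cx j) (cy j) (ob j) (x, y, o) = mu (x, y) * (fA o x * fB o y).
Proof.
rewrite /joint /marg big_mkcond /=.
rewrite -(pair_big xpredT xpredT (fun (a : XT) (b : YT) =>
  if (cx j (a, b), cy j (a, b), ob j (a, b)) == (x, y, o) then post (a, b) else 0)) /=.
rewrite /fA /fB /Rdiv -!Rsum_mulr -Rsum_mull [RHS]big_mkcond; apply: eq_bigr => a _.
case: and3P => [[/eqP ax /eqP ao aA]|na]; last first.
  rewrite big1 // => b _; case: eqP => // e; case: na; split.
  - by case: e => <-.
  - by case: e => _ _ <-.
  - case: e => _ _ <- /=; have := leafE a b (lf a b); rewrite eqxx => /esym /andP[].
    by [].
rewrite -!Rsum_mull [RHS]big_mkcond; apply: eq_bigr => b _ /=.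
rewrite !xpair_eqE /cx /cy /ob /= ax eqxx /=.
case: o ao aA => [[oa ob'] om] /= ao aA.
rewrite !xpair_eqE leafE aA ao eqxx /=.
case: (b j =P y) => //= bj; case: (keep_on y0 _ b =P ob') => //= bo.
case: (boolP (pB om b)) => //= bB.
have lfE : lf a b = om by apply/eqP; rewrite leafE aA.
have oaE i : i \in lower C j -> oa i = a i by move=> h; rewrite -ao ffunE h.
have obE i : i \in upper C j -> ob' i = b i by move=> h; rewrite -bo ffunE h.
have -> : [forall (i | i \in C), (oa i, b i, out om i) \in f] = win C (a, b).
  apply: eq_forallb => i; case: (boolP (i \in C)) => //= iC.
  by rewrite /ok /= lfE oaE // inE iC orbT.
rewrite /post; case: (win C (a, b)) => //.
rewrite /wgt (prod_split _ jC) /= ax bj /Rdiv -!Rmult_assoc; congr (_ * _ * _ * _).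
  by apply: eq_bigr => i /andP[_ ij]; rewrite obE // inE ij.
by apply: eq_bigr => i h; rewrite oaE.
Qed.

Lemma klAB_ge0 : 0 <= klA post mu (cx j) (cy j) (ob j) + klB post mu (cx j) (cy j) (ob j).
Proof.
have gen (A : finType) (phi : XT * YT -> A) (h : X * Y -> A) :
    (forall w, h (cx j w, cy j w) = phi w) ->
    0 <= kl (joint post (cx j) (cy j) (ob j)) (fun u => mu u.1 * cmarg post phi (ob j) (h u.1) u.2).
  move=> hE; apply: kl_marg_ge0; first exact: post_ge0.
  - exact: post_sum1.
  - by move=> u; apply: Rmult_le_pos => //; exact/cmarg_ge0/post_ge0.
  - rewrite -(pair_big xpredT xpredT (fun i k => mu i * cmarg post phi (ob j) (h i) k)) /= -mu1.
    apply: Rsum_le => u _; rewrite Rsum_mull -[X in _ <= X]Rmult_1_r.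
    by apply: Rmult_le_compat_l => //; exact: sum_cmarg.
  - move=> w pw; rewrite /= hE; apply: Rmult_lt_0_compat; first by case/post_gt0: pw => _; apply.
    exact/cmarg_gt0/pw/post_ge0.
have hA := gen _ (cy j) snd (fun _ => erefl); have hB := gen _ (cx j) fst (fun _ => erefl).
rewrite /klA /klB; lra.
Qed.

End Coordinate.
End Fixed.
End Conditioning.

Lemma Rsum_card (I : finType) (S : {set I}) : \sum_(i | i \in S) 1 = INR #|S|.
Proof.
rewrite big_const; elim: #|S| => [|n IH]; first by [].
by rewrite iterS IH S_INR; lra.
Qed.

Lemma Rsum_pred_compl (I : finType) (D : pred I) (F : I -> R) :
  \sum_(i | D i) F i + \sum_(i | ~~ D i) F i = \sum_i F i.
Proof. by rewrite [RHS](bigID D). Qed.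

(** The tangent at 1 gives [exp (u / 2) >= exp 1 * (u / 2)]; moreover [exp 1 >= (5/4) ^ 4 >= 2.44],
    and [1.22 ^ 2 >= 1.48]. *)
Lemma exp_ge_quadratic (u : R) : 0 <= u -> 1.48 * (u * u) <= exp u.
Proof.
move=> u0; have e14 := exp_ineq1_le (1/4).
have -> : exp u = exp (u / 2) * exp (u / 2) by rewrite -exp_plus; congr exp; lra.
have -> : exp (u / 2) = exp (1/4) * exp (1/4) * (exp (1/4) * exp (1/4)) * exp (u / 2 - 1).
  by rewrite -!exp_plus; congr exp; lra.
have h := exp_ineq1_le (u / 2 - 1).
set e := exp (1/4) in e14 *; set v := exp _ in h *.
have e2 : 1.5625 <= e * e by nra.
have e4 : 2.44 <= e * e * (e * e) by nra.
have : 1.22 * u <= e * e * (e * e) * v by nra.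
by move=> b; nra.
Qed.

Lemma exp_sub1_le (x : R) : 0 <= x -> x <= 1 / 2 -> exp x - 1 <= x * (1 + 2 * x).
Proof.
move=> x0 x1; have h := exp_ineq1_le (- x).
have e0 := exp_pos x.
have : exp x * exp (- x) = 1 by rewrite -exp_plus Rplus_opp_r exp_0.
move=> e; have : exp x * (1 - x) <= 1 by nra.
nra.
Qed.

Lemma exists_le_weighted_avg (I : Type) (s : seq I) (w F : I -> R) (c : R) :
  (forall i, List.In i s -> 0 <= w i) -> \sum_(i <- s) w i = 1 ->
  \sum_(i <- s) w i * F i <= c -> exists2 i, List.In i s & F i <= c.
Proof.
move=> w0 w1 wF.
have [m ms min] : exists2 m, List.In m s & forall i, List.In i s -> F m <= F i.
  have : s <> [::] by move=> e; move: w1; rewrite e big_nil; lra.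
  elim: (s) => // a [|b s'] IH _; first by exists a; [left | move=> i [<-|//]; lra].
  have [m ms min] := IH ltac:(done); case: (Rle_dec (F a) (F m)) => h.
    by exists a; [left | move=> i [<-|/min]; lra].
  by exists m; [right | move=> i [<-|/min]; lra].
exists m => //; apply: Rle_trans wF; rewrite -[F m]Rmult_1_l -w1 -Rsum_mulr.
elim: (s) w0 min => [|a s' IH] w0 min; first by rewrite !big_nil; lra.
rewrite !big_cons; apply: Rplus_le_compat.
  by apply: Rmult_le_compat_l; [apply: w0; left | apply: min; left].
by apply: IH => i h; [apply: w0; right | apply: min; right].
Qed.

(** * Finding a coordinate that fails given success on [C] *)

Section Step.
Variables (X Y Z M : finType) (f g : relation3 X Y Z) (t : nat) (mu : X * Y -> R).
Variables (x0 : X) (y0 : Y) (z : Z).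
Local Notation XT := {ffun 'I_t -> X}.
Local Notation YT := {ffun 'I_t -> Y}.
Variables (lf : XT -> YT -> M) (pA : M -> XT -> bool) (pB : M -> YT -> bool).
Variables (out : M -> {ffun 'I_t -> Z}) (C : {set 'I_t}).
Variables (eps delta e0 S lam : R).
Hypothesis mu0 : forall u, 0 <= mu u.
Hypothesis mu1 : \sum_u mu u = 1.
Hypothesis leafE : forall a b m, (lf a b == m) = pA m a && pB m b.
Local Notation sc := (succ f mu lf out).
Local Notation beta := (prob mu (fun u => rel_at f u.1 u.2 == [set z])).
Hypothesis s0 : 0 < sc C.
Hypothesis eps0 : 0 < eps.
Hypothesis eps1 : 55 * eps < 1.
Hypothesis e00 : 0 <= e0.
Hypothesis S10 : 10 < S.
Hypothesis Seps : 2 < 11 * eps * S.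
Hypothesis lamS : S / 8 <= lam.
Hypothesis close : prob mu (fun u => rel_at f u.1 u.2 != rel_at g u.1 u.2) <= delta.
Hypothesis rect : forall AB, e0 * (prob mu (in_rect AB) - exp (- (4 * lam))) <=
  prob mu (fun u => in_rect AB u && (z \notin rel_at g u.1 u.2)).
Hypothesis gap : delta + 22 * eps < e0 * (beta - 33 * eps).

Local Notation P := (post f mu lf out C).
Let kAB j := klA P mu (cx j) (cy j) (ob x0 y0 lf C j) + klB P mu (cx j) (cy j) (ob x0 y0 lf C j).

Let P0 : forall w, 0 <= P w := post_ge0 mu0 s0.
Let P1 : \sum_w P w = 1 := post_sum1 s0.

(** [kl_event] with [lam = eps]: after division by [eps], the divergence contributes [eps] and the
    error of [exp eps - 1] contributes [2 * eps]. *)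
Lemma post_event (j : 'I_t) (E : pred (X * Y)) : kl0 f mu lf out C j <= eps * eps ->
  \sum_(w | E (cx j w, cy j w)) P w <= prob mu E + 3 * eps.
Proof.
move=> k0.
have pe : prob mu E <= 1 by rewrite -mu1; exact: Rsum_subpred.
have pe0 : 0 <= prob mu E by exact: Rsum_ge0.
have := @kl_event _ (marg P (fun w => (cx j w, cy j w))) mu E eps
  (marg_ge0 P0 _) mu0.
have h1 : forall u, 0 < marg P (fun w => (cx j w, cy j w)) u -> 0 < mu u.
  by move=> u /(gt0_of_marg P0)[w <-] /(post_gt0 mu0) [_]; apply.
have h2 : \sum_u marg P (fun w => (cx j w, cy j w)) u = 1 by rewrite marg_sum.
have h3 : \sum_u mu u <= 1 by rewrite mu1; lra.
move=> /(_ h1 h2 h3); rewrite sum_marg_pred -/(kl0 _ _ _ _ _ _) -/(prob mu E) => main.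
have ee := @exp_sub1_le eps ltac:(lra) ltac:(lra).
apply: (Rmult_le_reg_l eps) => //.
apply: Rle_trans main _.
have : (exp eps - 1) * prob mu E <= eps * (1 + 2 * eps) * prob mu E by apply: Rmult_le_compat_r.
nra.
Qed.

(** If coordinate [j] succeeded with probability [1 - eps], the rectangles of [single_copy] would
    contain too few points with [z] outside [g], against [rect]. *)
Lemma failing_coordinate (j : 'I_t) : j \notin C ->
  kl0 f mu lf out C j <= eps * eps -> kAB j <= 0.03 * eps * S ->
  sc (j |: C) < (1 - eps) * sc C.
Proof.
move=> jC k0 kj; apply: Rnot_le_lt => win_j.
pose okj := ok f lf out j.
have fail : \sum_(w | ~~ okj w) P w <= eps.
  have e := Rsum_pred_compl okj P; rewrite P1 in e.
  suff : 1 - eps <= \sum_(w | okj w) P w by lra.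
  have -> : \sum_(w | okj w) P w = sc (j |: C) / sc C.
    rewrite /succ /Rdiv -Rsum_mulr big_mkcond [RHS]big_mkcond; apply: eq_bigr => w _.
    rewrite /post; have -> : win f lf out (j |: C) w = okj w && win f lf out C w.
      apply/forall_inP/andP => [h|[h /forall_inP h'] i].
        by split; [apply: h; rewrite setU11 | apply/forall_inP => i iC; apply: h; rewrite setU1r].
      by rewrite in_setU1 => /orP[/eqP->|/h'].
    by case: (okj w).
  apply: (Rmult_le_reg_r (sc C)) => //.
  by rewrite /Rdiv Rmult_assoc Rinv_l; lra.
pose lab (o : XT * YT * M) := out o.2 j == z.
pose E (u : X * Y) := z \notin rel_at g u.1 u.2.
(* If [z] is output but lies outside [g], then [f] and [g] differ there or the output is wrong. *)
have PE : \sum_(w | E (cx j w, cy j w) && lab (ob x0 y0 lf C j w)) P w <= delta + 4 * eps.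
  have d := post_event (fun u => rel_at f u.1 u.2 != rel_at g u.1 u.2) k0.
  apply: Rle_trans (_ : _ <= \sum_(w | rel_at f (cx j w) (cy j w) != rel_at g (cx j w) (cy j w)) P w +
     \sum_(w | ~~ okj w) P w) _; last first.
    by apply: Rle_trans (Rplus_le_compat _ _ _ _ (Rle_trans _ _ _ d (Rplus_le_compat_r _ _ _ close)) fail) _; lra.
  rewrite big_mkcond [X in _ <= X + _]big_mkcond [X in _ <= _ + X]big_mkcond -big_split.
  apply: Rsum_le => w _ /=; have p0 := P0 w.
  case: ifP => [/andP[zg /eqP oz]|_]; last by do 2!case: ifP => _; lra.
  case: eqP => [fg|_] /=; last by case: ifP; lra.
  have -> : okj w = false by apply/negbTE; move: zg; rewrite /E -fg inE -oz.
  by rewrite /=; lra.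
(* If [z] is the only valid answer and the output is correct, then [z] is output. *)
have PL : beta - 4 * eps <= \sum_(w | lab (ob x0 y0 lf C j w)) P w.
  have d := post_event (fun u => rel_at f u.1 u.2 != [set z]) k0.
  have b : beta + prob mu (fun u => rel_at f u.1 u.2 != [set z]) = 1.
    by rewrite -mu1; exact: Rsum_pred_compl.
  have tr a b' n x y : b' + n = 1 -> x <= n + 3 * eps -> y <= eps -> 1 <= a + x + y ->
    b' - 4 * eps <= a by lra.
  apply: (tr _ _ _ _ _ b d fail).
  rewrite -P1 [X in _ <= X + _ + _]big_mkcond [X in _ <= _ + X + _]big_mkcond.
  rewrite [X in _ <= _ + X]big_mkcond -!big_split; apply: Rsum_le => w _ /=; have p0 := P0 w.
  case: (boolP (okj w)) => okw /=; last by do 2!case: ifP => _; lra.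
  case: eqP => [fz|_] /=; last by case: ifP => _; lra.
  have -> : lab (ob x0 y0 lf C j w) by rewrite /lab /= -in_set1 -fz inE.
  lra.
have PL1 : \sum_(w | lab (ob x0 y0 lf C j w)) P w <= 1 by rewrite -P1; exact: Rsum_subpred.
set L := exp lam; have L0 : 0 < L by exact: exp_pos.
have L2 : 2.25 <= L by have := exp_ineq1_le lam; rewrite -/L; lra.
(* Chosen so that the quadratic error [(p * L) * (p * L)] is [p * (18 * eps)], which leaves
   [18 * eps] after division by [p]. *)
set p := 18 * eps * / (L * L).
have iL : 0 < / (L * L) by apply: Rinv_0_lt_compat; nra.
have p0 : 0 < p by apply: Rmult_lt_0_compat => //; lra.
have pLE : p * L = 18 * eps / L by rewrite /p; field; lra.
have pL8 : p * L <= 8 * eps.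
  rewrite pLE; apply: (Rmult_le_reg_r L) => //.
  have -> : 18 * eps / L * L = 18 * eps by field; lra.
  nra.
have pL0 : 0 <= p * L by apply: Rmult_le_pos; lra.
set sig := exp (- (2 * lam)) / (18 * eps).
have sigE : exp (- (4 * lam)) = p * sig.
  have LL : / (L * L) = exp (- (2 * lam)) by rewrite exp_Ropp /L -exp_plus; congr (/ exp _); lra.
  rewrite /p LL /sig; have -> : exp (- (4 * lam)) = exp (- (2 * lam)) * exp (- (2 * lam)).
    by rewrite -exp_plus; congr exp; lra.
  by field; lra.
(* [sig] is of order [exp (- (2 * lam)) / eps]; [Seps] makes [lam] at least of order [/ eps], so the
   quadratic bound on [exp] gains the missing [eps * eps]. *)
have sig20 : sig <= 19.8 * eps.
  have q := @exp_ge_quadratic (2 * lam) ltac:(lra).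
  have u22 : 1 <= 22 * eps * (2 * lam) by nra.
  rewrite /sig exp_Ropp; set e := exp (2 * lam) in q *.
  have ep : 0 < e by exact: exp_pos.
  apply: (Rmult_le_reg_r (18 * eps * e)); first by nra.
  have -> : / e / (18 * eps) * (18 * eps * e) = 1 by field; lra.
  set u := 2 * lam in q u22.
  have a1 : 1 <= (22 * eps * u) * (22 * eps * u) by nra.
  have a2 : 0 <= eps * eps by nra.
  have : 1.48 * (u * u) * (eps * eps) <= e * (eps * eps) by apply: Rmult_le_compat_r.
  nra.
have lam1 : 1 < lam by lra.
have plt : p * exp lam <= 1 by rewrite -/L; lra.
have main := single_copy P0 P1 mu0 mu1 (fA_ge0 x0 pA mu0 C j) (fB_ge0 y0 pB mu0 s0 j)
  (post_factor f mu x0 y0 out leafE jC) lab (E := E) e00 lam1 (Rlt_le _ _ p0) plt rect.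
rewrite -/L -/(kAB j) sigE in main.
set PLv := \sum_(w | lab (ob x0 y0 lf C j w)) P w in main PL PL1.
set PEv := \sum_(w | E (cx j w, cy j w) && lab (ob x0 y0 lf C j w)) P w in main PE.
set bad := kAB j / (lam - 1) in main.
have bad1 : bad <= 1.2 * eps.
  apply: (Rmult_le_reg_r (lam - 1)); first lra.
  have -> : bad * (lam - 1) = kAB j by rewrite /bad; field; lra.
  have : S / 40 <= lam - 1 by lra.
  nra.
have bad0 : 0 <= bad.
  apply: Rdiv_ge0; last lra.
  exact: klAB_ge0.
have pLLE : (p * L) * (p * L) = p * (18 * eps) by rewrite /p; field; lra.
rewrite pLLE in main.
have {}main : e0 * ((1 - p * L) * (PLv - bad) - sig) <= PEv + 18 * eps.
  by apply: (Rmult_le_reg_l p) => //; lra.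
(* The losses from [PL], [p * L], [bad] and [sig] add up as [4 + 8 + 1.2 + 19.8 = 33]; on the other
   side [4 + 18 = 22], contradicting [gap]. *)
have : e0 * (beta - 33 * eps) <= e0 * ((1 - p * L) * (PLv - bad) - sig).
  by apply: Rmult_le_compat_l => //; nra.
lra.
Qed.

Hypothesis t0 : (0 < t)%N.
Hypothesis Mle : ln (INR #|M|) <= eps ^ 2 / 32 * INR t * (11 * eps * S).
Hypothesis sle : - ln (sc C) <= eps ^ 3 * INR t / 16.
Hypothesis Cle : INR #|C| <= eps ^ 2 * INR t / 32.

(** Markov's inequality: otherwise every coordinate outside [C] exceeds one of the two divergence
    thresholds, while the sums of the divergences allow this only for a small fraction of the [t]
    coordinates. *)
Lemma exists_failing_coordinate : exists2 j, j \notin C & sc (j |: C) < (1 - eps) * sc C.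
Proof.
have T0 : 0 < INR t by apply: lt_0_INR; apply/ltP.
pose b := 0.03 * eps * S.
have b0 : 0 < b by rewrite /b; nra.
have ee : 0 < eps * eps by nra.
case: (pickP [pred j | [&& j \notin C, Rleb (kl0 f mu lf out C j) (eps * eps) & Rleb (kAB j) b]]).
  move=> j /and3P[jC /RlebP h1 /RlebP h2]; exists j => //.
  exact: failing_coordinate.
move=> no; exfalso.
have big j : j \notin C -> 1 <= kl0 f mu lf out C j * / (eps * eps) + kAB j * / b.
  move=> jC; have := no j; rewrite /= jC /=.
  have k1 := kl0_ge0 mu0 mu1 s0 j.
  have k2 : 0 <= kAB j by exact: klAB_ge0.
  have i1 : 0 < / (eps * eps) by exact: Rinv_0_lt_compat.
  have i2 : 0 < / b by exact: Rinv_0_lt_compat.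
  have r1 := Rinv_r (eps * eps) ltac:(lra); have r2 := Rinv_r b ltac:(lra).
  case: RlebP => h1; case: RlebP => h2 //= _; nra.
have : \sum_(j | j \notin C) 1 <=
  \sum_(j | j \notin C) (kl0 f mu lf out C j * / (eps * eps) + kAB j * / b).
  by apply: Rsum_le.
rewrite big_split /= !Rsum_mulr /kAB big_split /= => up.
have cnt : INR t - INR #|C| = \sum_(j | j \notin C) 1.
  have := Rsum_pred_compl (fun j => j \in C) (fun _ => 1).
  rewrite Rsum_card Rsum_const card_ord; lra.
rewrite -cnt in up.
have sA := sum_klA x0 y0 mu0 mu1 s0; have sB := sum_klB x0 y0 mu0 mu1 s0.
have sk := sum_kl0 mu0 mu1 s0.
set sumA := \big[Rplus/0]_(j | _) _ in sA up; set sumB := \big[Rplus/0]_(j | _) _ in sB up.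
set sum0 := \big[Rplus/0]_(j | _) _ in sk up.
have q1 : sum0 * / (eps * eps) <= eps * INR t / 16.
  apply: (Rmult_le_reg_r (eps * eps)) => //.
  rewrite Rmult_assoc Rinv_l; last lra.
  by move: sle; rewrite /=; lra.
have q2 : (sumA + sumB) * / b <= 25 * (eps * eps) * INR t.
  apply: (Rmult_le_reg_r b) => //.
  rewrite Rmult_assoc Rinv_l; last lra.
  have ab : sumA + sumB <= 2 * (eps ^ 3 * INR t / 16 + eps ^ 2 / 32 * INR t * (11 * eps * S)) by lra.
  rewrite Rmult_1_r; apply: Rle_trans ab _; rewrite /b /=.
  have e3 : 0 <= eps * eps * eps * INR t by apply: Rmult_le_pos; nra.
  have : eps * eps * eps * INR t * 10 <= eps * eps * eps * INR t * S by apply: Rmult_le_compat_l; lra.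
  lra.
have e1 : eps * INR t <= INR t / 55 by nra.
have e2 : eps * eps * INR t <= INR t / 3025 by nra.
move: Cle up; rewrite /=; lra.
Qed.
End Step.

(** * The direct product theorem *)

(** A nonzero maximum excludes the empty list, whose maximum is 0 by convention. *)
Lemma Rmax_seq_in (s : seq R) : Rmax_seq s <> 0 -> List.In (Rmax_seq s) s.
Proof.
case: s => [//|a s] _ /=; elim: s => [|b s IH] /=; first by left.
by rewrite /Rmax; case: Rle_dec => _; [case: IH => [<-|]; [left|right; right] | right; left].
Qed.

Lemma Rmin_seq_le (s : seq R) v : List.In v s -> Rmin_seq s <= v.
Proof.
case: s => [//|a s] /=; elim: s => [|b s IH] /=; first by case=> [->|//]; lra.
have h1 := Rmin_l b (foldr Rmin a s); have h2 := Rmin_r b (foldr Rmin a s).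
by case=> [e|[e|h]]; [have := IH (or_introl e) | subst v | have := IH (or_intror h)]; lra.
Qed.

Lemma In_map_filter_enum (T : finType) (B : Type) (F : T -> B) (a : pred T) (b : B) :
  List.In b [seq F x | x <- enum T & a x] <-> exists2 x, a x & b = F x.
Proof.
have gen (s : seq T) : List.In b [seq F x | x <- s & a x] <-> exists2 x, (x \in s) && a x & b = F x.
  elim: s => [|y s IH] /=; first by split=> [[]|[x]].
  case: ifP => ay /=; rewrite IH; split.
  - case=> [<-|[x /andP[xs ax] ->]]; first by exists y; rewrite ?inE ?eqxx.
    by exists x; rewrite // inE xs orbT.
  - case=> x /andP[]; rewrite inE => /orP[/eqP->|xs] ax ->; [by left | right].
    by exists x; rewrite ?xs.
  - by case=> x /andP[xs ax] ->; exists x; rewrite // inE xs orbT.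
  - case=> x /andP[]; rewrite inE => /orP[/eqP->|xs] ax ->; first by rewrite ay in ax.
    by exists x; rewrite ?xs.
rewrite gen; split=> -[x].
  by move=> /andP[_ ax] ->; exists x.
by move=> ax ->; exists x; rewrite ?mem_enum.
Qed.

Lemma INR_nat_floor (x : R) : 0 <= x -> INR (nat_floor x) <= x.
Proof.
move=> x0; have [h1 h2] := base_Int_part x.
rewrite /nat_floor INR_IZR_INZ Z2Nat.id //.
have : (-1 < Int_part x)%Z by apply: lt_IZR; lra.
lia.
Qed.

(** Take [g] attaining the maximum. A rectangle larger than [2 ^ (- srec)] cannot be admissible for
    [g], so [z] fails on more than a fraction [e0] of it. The second form is linear and trivial for
    small rectangles, as averaging requires. *)
Lemma srec_witness (X Y Z : finType) (mu : X * Y -> R) (f : relation3 X Y Z) (z : Z)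
    (e0 delta : R) :
  (forall u, 0 <= mu u) -> 0 <= e0 -> 0 < srec mu f z e0 delta ->
  exists g : relation3 X Y Z,
    prob mu (fun u => rel_at f u.1 u.2 != rel_at g u.1 u.2) <= delta /\
    forall AB, let r := prob mu (in_rect AB) in
      let sig := exp (- (srec mu f z e0 delta * ln 2)) in
      (sig < r -> e0 * r < prob mu (fun u => in_rect AB u && (z \notin rel_at g u.1 u.2))) /\
      e0 * (r - sig) <= prob mu (fun u => in_rect AB u && (z \notin rel_at g u.1 u.2)).
Proof.
set S := srec _ _ _ _ _ => mu0 e00 S0.
have : List.In S [seq rec mu g z e0 | g <- enum {: relation3 X Y Z}
           & Rleb (prob mu (fun p => rel_at f p.1 p.2 != rel_at g p.1 p.2)) delta].
  by apply: Rmax_seq_in; rewrite -/(srec mu f z e0 delta) -/S; lra.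
move=> /In_map_filter_enum [g /RlebP close Sg]; exists g; split=> // AB r sig.
have ln2 : 0 < ln 2 by have := ln_lt_2; lra.
set v := prob _ _; have v0 : 0 <= v by exact: Rsum_ge0.
have s0 : 0 < sig by exact: exp_pos.
have strict : sig < r -> e0 * r < v.
  move=> sr.
  have nok : ~~ rect_ok mu g z e0 AB.
    apply/negP => okAB.
    have : S <= log2 (/ r).
      by rewrite Sg; apply: Rmin_seq_le; apply/In_map_filter_enum; exists AB.
    rewrite /log2 ln_Rinv; last lra.
    move=> h.
    have : S * ln 2 <= - ln r.
      have := Rmult_le_compat_r (ln 2) _ _ (Rlt_le _ _ ln2) h.
      by have -> : - ln r / ln 2 * ln 2 = - ln r by field; lra.
    move=> h2; have : ln sig < ln r by apply: ln_increasing.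
    by rewrite /sig ln_exp; lra.
  move: nok; rewrite /rect_ok -/r; case: RltbP => [_|]; last lra.
  case: RlebP => // nle _.
  have : prob mu (fun p => in_rect AB p && (z \in rel_at g p.1 p.2)) + v = r.
    rewrite /r /v /prob [RHS](bigID (fun p => z \in rel_at g p.1 p.2)) /=.
    by [].
  lra.
split=> //; case: (Rlt_le_dec sig r) => h; first by have := strict h; nra.
by apply: Rle_trans v0; nra.
Qed.

Theorem theorem1 (X Y Z : finType) (f : relation3 X Y Z) (t : nat)
  (mu : X * Y -> R) (z : Z) (eps eps' delta : R) :
  (1 < t)%N ->
  is_distr mu ->
  let beta := prob mu (fun p => rel_at f p.1 p.2 == [set z]) in
  0 < eps -> eps < 1 / 3 -> 0 < eps' -> 0 < delta ->
  33 * eps < beta ->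
  (delta + 22 * eps) / (beta - 33 * eps) < (1 + eps') * (delta / beta) ->
  Rpub_ge (rel_pow f (t:=t))
    (1 - (1 - eps) ^ nat_floor (eps ^ 2 * INR t / 32))
    (eps ^ 2 / 32 * INR t *
       (11 * eps * srec mu f z ((1 + eps') * delta / beta) delta - 2)).
Proof.
move=> t1 [mu0 mu1] beta eps0 _ eps'0 delta0 beta33 hyp Pi [Pi0 Pi1] err.
set k := nat_floor _ in err *; set e0 := (1 + eps') * delta / beta.
set S := srec _ _ _ _ _; set c := pub_cost Pi.
apply: Rnot_lt_le => small.
have T0 : 0 < INR t by apply: lt_0_INR; apply/ltP; apply: ltn_trans t1.
have c0 : 0 <= INR c by exact: pos_INR.
have q0 : 0 < eps ^ 2 / 32 * INR t by apply: Rmult_lt_0_compat => //; nra.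
(* The cost is nonnegative, so a bound exceeding it is positive. *)
have Seps : 2 < 11 * eps * S.
  by apply: Rnot_le_lt => h; have := Rmult_le_compat_l _ _ _ (Rlt_le _ _ q0) (_ : 11 * eps * S - 2 <= 0); lra.
have S0 : 0 < S by nra.
have e00 : 0 <= e0.
  by rewrite /e0; apply: Rdiv_ge0; [apply: Rmult_le_pos; lra | lra].
have gap : delta + 22 * eps < e0 * (beta - 33 * eps).
  have := Rmult_lt_compat_r (beta - 33 * eps) _ _ ltac:(lra) hyp.
  have -> : (delta + 22 * eps) / (beta - 33 * eps) * (beta - 33 * eps) = delta + 22 * eps.
    by field; lra.
  by have -> : (1 + eps') * (delta / beta) = e0 by rewrite /e0; field; lra.
have [g [close rect]] := srec_witness mu0 e00 S0.
rewrite -/S in rect.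
have ln2 := ln_lt_2.
have beta1 : beta <= 1 by rewrite -mu1; exact: Rsum_subpred.
(* Apply the strict form to the whole space; with [gap] this then forces [55 * eps < 1]. *)
have e01 : e0 < 1.
  have [strict _] := rect (setT, setT).
  have full : prob mu (in_rect ([set: X], [set: Y])) = 1.
    by rewrite -mu1; apply: eq_bigl => u; rewrite /in_rect !inE.
  rewrite full Rmult_1_r in strict.
  have s1 : exp (- (S * ln 2)) < 1.
    by rewrite -exp_0; apply: exp_increasing; nra.
  apply: Rlt_le_trans (strict s1) _; rewrite -mu1; exact: Rsum_subpred.
have eps55 : 55 * eps < 1 by nra.
have S10 : 10 < S by nra.
(* Hence [exp (- (4 * lam))] is [2 ^ (- S)], and the sampling rate of order [exp (- (2 * lam))] is
   about [2 ^ (- S / 2)]. *)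
pose lam := S * ln 2 / 4.
have lam4 : S * ln 2 = 4 * lam by rewrite /lam; lra.
have lamS : S / 8 <= lam by rewrite /lam; nra.
have rect' AB : e0 * (prob mu (in_rect AB) - exp (- (4 * lam))) <=
   prob mu (fun u => in_rect AB u && (z \notin rel_at g u.1 u.2)).
  by rewrite -lam4; case: (rect AB).
pose W := ({ffun 'I_t -> X} * {ffun 'I_t -> Y})%type.
pose wg (w : W) := \prod_i mu (w.1 i, w.2 i).
have wg0 w : 0 <= wg w by exact: Rprod_ge0.
have wg1 : \sum_w wg w = 1 by exact: sum_wgt.
(* Fix the coins: some deterministic protocol has average error under the product law no larger than
   the worst-case bound. *)
have [wp wpIn wpErr] : exists2 wp, List.In wp Pi &
    \sum_(w : W | ~~ rel_pow f w.1 w.2 (run wp.2 w.1 w.2)) wg w <= 1 - (1 - eps) ^ k.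
  apply: (@exists_le_weighted_avg _ Pi (fun wp => wp.1)) => //.
  apply: Rle_trans (_ : _ <= \sum_(w : W) wg w * (1 - (1 - eps) ^ k)) _; last first.
    by rewrite Rsum_mulr wg1; lra.
  apply: Rle_trans (_ : _ <= \sum_(w : W) wg w * pub_err (rel_pow f (t:=t)) Pi w.1 w.2) _; last first.
    by apply: Rsum_le => w _; apply: Rmult_le_compat_l.
  right; rewrite /pub_err.
  under eq_bigr => p _ do rewrite -Rsum_mull big_mkcond.
  rewrite exchange_big; apply: eq_bigr => w _; rewrite -Rsum_mull [RHS]big_mkcond.
  by apply: eq_bigr => p _; case: ifP => _ //; exact: Rmult_comm.
have depth_c : (depth wp.2 <= c)%N.
  rewrite /c /pub_cost; elim: (Pi) wpIn => //= a s IH [->|/IH h]; rewrite big_cons.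
    exact: leq_maxl.
  exact: leq_trans h (leq_maxr _ _).
have [M [lf [pA [pB [out [cardM leafE runE]]]]]] := proto_leaves wp.2.
have [x0 [y0 _]] : exists x0 : X, exists y0 : Y, True.
  case: (pickP (@predT (X * Y)%type)) => [[x y] _|no]; first by exists x, y.
  by move: mu1; rewrite big_pred0 => [|u]; [lra | have := no u].
pose sc := succ f mu lf out.
have sc_ge C : (1 - eps) ^ k <= sc C.
  apply: Rle_trans (_ : _ <= \sum_(w : W | rel_pow f w.1 w.2 (run wp.2 w.1 w.2)) wg w) _.
    have tr a b : a + b = 1 -> b <= 1 - (1 - eps) ^ k -> (1 - eps) ^ k <= a by lra.
    by apply: tr wpErr; rewrite -[RHS]wg1; exact: Rsum_pred_compl.
  apply: Rsum_subpred => // w /forallP h; apply/forall_inP => i _.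
  by have := h i; rewrite runE.
have pw n : 0 < (1 - eps) ^ n by apply: pow_lt; lra.
have Mpos := card_leaf_gt0 x0 y0 lf.
have lnM : ln (INR #|M|) <= eps ^ 2 / 32 * INR t * (11 * eps * S).
  apply: Rle_trans (_ : _ <= INR c) _; last by nra.
  have pow2 n : INR (2 ^ n)%N = exp (INR n * ln 2).
    elim: n => [|n IH]; first by rewrite Rmult_0_l exp_0.
    rewrite expnS mult_INR IH [INR n.+1]S_INR Rmult_plus_distr_r Rmult_1_l exp_plus exp_ln /=; lra.
  have : INR #|M| <= exp (INR c * ln 2).
    rewrite -pow2; apply: le_INR; apply/leP; apply: leq_trans cardM _.
    by rewrite leq_exp2l.
  move=> h; have : ln (INR #|M|) <= INR c * ln 2.
    rewrite -(ln_exp (INR c * ln 2)); case: h => [h|->]; last lra.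
    by left; apply: ln_increasing.
  have : ln 2 <= 1.
    have := @ln_ge_1sub (/ 2) ltac:(lra); rewrite ln_Rinv ?Rinv_inv; lra.
  nra.
have kle : INR k <= eps ^ 2 * INR t / 32.
  by apply: INR_nat_floor; have := q0; lra.
have lneps : - ln (1 - eps) <= 2 * eps.
  have := @ln_ge_1sub (1 - eps) ltac:(lra).
  have : / (1 - eps) <= 1 + 2 * eps; last lra.
  by apply: (Rmult_le_reg_l (1 - eps)); [lra | rewrite Rinv_r; nra].
have scle C : - ln (sc C) <= eps ^ 3 * INR t / 16.
  have : ln ((1 - eps) ^ k) <= ln (sc C).
    by case: (sc_ge C) => [h|->]; [left; apply: ln_increasing | right].
  rewrite ln_pow; last lra.
  have k0 := pos_INR k.
  have : INR k * - ln (1 - eps) <= INR k * (2 * eps) by apply: Rmult_le_compat_l.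
  have : INR k * (2 * eps) <= eps ^ 2 * INR t / 32 * (2 * eps) by apply: Rmult_le_compat_r; lra.
  move=> /=; lra.
(* Coordinates are added one at a time. At least one is added even if [k = 0], so that the final
   inequality is strict and contradicts [sc_ge]. *)
have greedy n : (n <= maxn k 1)%N -> exists C : {set 'I_t},
    [/\ #|C| = n, sc C <= (1 - eps) ^ n & (0 < n)%N -> sc C < (1 - eps) ^ n].
  elim: n => [_|n IH nk].
    exists set0; split=> //; first by rewrite cards0.
    by rewrite /= -wg1; apply: Rsum_subpred.
  have [C [cC sC _]] := IH (ltnW nk).
  have nk' : (n <= k)%N.
    by move: nk; rewrite leq_max => /orP[/ltnW|]; rewrite // ltnS leqn0 => /eqP->.
  have Cle : INR #|C| <= eps ^ 2 * INR t / 32.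
    by apply: Rle_trans kle; rewrite cC; apply: le_INR; apply/leP.
  have scC0 : 0 < sc C by apply: Rlt_le_trans (sc_ge C).
  have [j jC lt] := exists_failing_coordinate x0 y0 mu0 mu1 leafE scC0 eps0 eps55 e00 S10 Seps
    lamS close rect' gap (ltnW t1) lnM (scle C) Cle.
  have lt' : sc (j |: C) < (1 - eps) ^ n.+1.
    apply: Rlt_le_trans lt _; rewrite /=; apply: Rmult_le_compat_l => //; lra.
  by exists (j |: C); split=> // [|]; [rewrite cardsU1 jC cC | lra].
have [C [_ _ lt]] := greedy _ (leqnn _).
have {}lt := lt (leq_maxr _ _).
have := sc_ge C; suff : (1 - eps) ^ maxn k 1 <= (1 - eps) ^ k by lra.
rewrite -(subnKC (leq_maxl k 1)) pow_add -[X in _ <= X]Rmult_1_r.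
apply: Rmult_le_compat_l; first by left.
by have := pow_incr (1 - eps) 1 (maxn k 1 - k) ltac:(lra); rewrite pow1.
Qed.
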